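(* Let $Y=(Y_t:t>0)$ be the STIT tessellation process on $\mathbb{R}^\ell$ driven by $\Lambda$, and let $W$ be a window containing the origin $0$ in its interior. Let $\vec{R}^-=(R^k:k\in\mathbb{Z}_-)$ be a random sequence of independent copies of $Y_1\wedge W$, where $\mathbb{Z}_-=\{n\in\mathbb{Z}:n\le 0\}$. Then, for $a>1$, $$\forall k\in\mathbb{Z}_-:\quad \mathbb{P}\big(\partial R^k\cap\mathrm{int}(a^kW)=\emptyset\big)=\mathbb{P}\big(\partial R^0\cap\mathrm{int}(W)=\emptyset\big)^{a^k},$$ and $$\mathbb{P}\big(\forall k\in\mathbb{Z}_-:\ \partial R^k\cap\mathrm{int}(a^kW)=\emptyset\big)=\mathbb{P}\big(\partial R^0\cap\mathrm{int}(W)=\emptyset\big)^{\frac{a}{a-1}}>0.$$ Moreover, with probability $1$ there exists a strictly increasing sequence of integers $(n_i\ge 1:i\in\mathbb{N})$ (depending on $\vec{R}^-$) such that $$\forall i\in\mathbb{N}\ \forall k\in\mathbb{Z}_-:\quad \partial R^{-n_i+k}\cap\mathrm{int}(a^kW)=\emptyset .$$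
   Context: Fix $\ell\ge 1$. A polytope is the convex hull of a finite point set in $\mathbb{R}^\ell$, always assumed to have nonempty interior. A tessellation of $\mathbb{R}^\ell$ is a countable, locally finite family of polytopes (cells) with pairwise disjoint interiors and union $\mathbb{R}^\ell$; $\mathbb{T}$ is the set of all tessellations, a Borel subset of the space $\mathbb{F}(\mathbb{F}')$ of closed subsets (with the Fell topology) of the space $\mathbb{F}'$ of nonempty closed subsets of $\mathbb{R}^\ell$ (with the Fell topology). A window $W$ is a polytope with nonempty interior; $\mathbb{T}_W$ is the set of (finite) tessellations of $W$ into polytopes with disjoint interiors, with the Borel $\sigma$-field obtained in the same way (closed subsets, with the Fell topology, of the space of nonempty closed subsets of $W$). For $T\in\mathbb{T}$, $T\wedge W=\{C\cap W:C\in T,\ \mathrm{int}(C\cap W)\ne\emptyset\}\in\mathbb{T}_W$. The boundary of a tessellation $R$ is the union of the boundaries of its cells, $\partial R=\bigcup_{C\in R}\partial C$. For $c\in\mathbb{R}$ and $B\subseteq\mathbb{R}^\ell$, $cB=\{cx:x\in B\}$. $\mathbb{N}=\{1,2,\dots\}$. STIT process. Let $\Lambda$ be a nonzero $\sigma$-finite translation invariant measure on the space $\mathcal{H}$ of hyperplanes of $\mathbb{R}^\ell$ such that there is no line to which all hyperplanes of the support of $\Lambda$ are parallel. For a set $B\subseteq\mathbb{R}^\ell$ put $[B]=\{H\in\mathcal{H}:H\cap B\ne\emptyset\}$; one has $0<\Lambda([W])<\infty$ for every window $W$, and $\Lambda_W=\Lambda([W])^{-1}\Lambda(\cdot\cap[W])$.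 For a window $W$, $Y\wedge W=(Y_t\wedge W:t\ge 0)$ is the pure jump càdlàg Markov process in $\mathbb{T}_W$ starting from $Y_0\wedge W=\{W\}$ in which, independently, each present cell $C$ has an exponential lifetime with parameter $\Lambda([C])$, at the end of which $C$ is replaced by the two cells into which it is divided by a random hyperplane of law $\Lambda_C$ (independent of everything else). These laws are consistent: $(Y\wedge W')\wedge W\sim Y\wedge W$ for $W\subseteq W'$, where $\sim$ denotes equality of distributions. The STIT tessellation process $Y=(Y_t:t>0)$ is the $\mathbb{T}$-valued Markov process whose restriction to each window $W$ has this law. *)

(* Defs.v *)
From HB Require Import structures.
From mathcomp Require Import all_boot all_order all_algebra.
From mathcomp Require Import all_classical all_reals all_analysis.
From mathcomp Require Import measurable_realfun.

Set Implicit Arguments.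
Unset Strict Implicit.
Unset Printing Implicit Defensive.

Import Order.TTheory GRing.Theory Num.Theory.
Import numFieldNormedType.Exports.

Local Open Scope classical_set_scope.
Local Open Scope ring_scope.

Record fell (E : topologicalType) := Fell {
  fell_set :> set E ;
  fell_closed : closed fell_set }.

HB.instance Definition _ (E : topologicalType) := gen_eqMixin (fell E).
HB.instance Definition _ (E : topologicalType) := gen_choiceMixin (fell E).
HB.instance Definition _ (E : topologicalType) :=
  isPointed.Build (fell E) (Fell (@closed0 E)).

Definition fell_miss (E : topologicalType) (K : set E) : set (fell E) :=
  [set F : fell E | (F : set E) `&` K = set0].

Definition fell_hit (E : topologicalType) (G : set E) : set (fell E) :=
  [set F : fell E | (F : set E) `&` G !=set0].

Definition fell_subbase (E : topologicalType) : set (set (fell E)) :=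
  [set fell_miss K | K in compact] `|` [set fell_hit G | G in open].

HB.instance Definition _ (E : topologicalType) :=
  @isSubBaseTopological.Build (fell E) (set (fell E)) (@fell_subbase E) idfun.

Definition borelType (T : ptopologicalType) := g_sigma_algebraType (@open T).
HB.instance Definition _ (T : ptopologicalType) :=
  Measurable.on (borelType T).

Section Geometry.
Variables (R : realType) (l : nat).
(* The ambient space is R^ell with ell = l.+1 >= 1. *)
Notation V := 'rV[R]_l.+1.

Definition dot (u x : V) : R := \sum_i u ord0 i * x ord0 i.

Definition convex_hull (S : set V) : set V := smallest (@convex_set R V) S.

Definition polytope (C : set V) : Prop :=
  (exists2 S : set V, finite_set S & C = convex_hull S) /\ C° !=set0.

Definition dilate (c : R) (B : set V) : set V := [set c *: x | x in B].

Definition polytopal_cover (D : set V) (T : set (set V)) : Prop :=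
  [/\ T `<=` polytope, trivIset T (@interior V) & \bigcup_(C in T) C = D].

Definition tessellation (T : set (set V)) : Prop :=
  [/\ countable T,
      forall K, compact K -> finite_set (T `&` [set C | C `&` K !=set0]) &
      polytopal_cover setT T].

Definition window_tessellation (W : set V) (T : set (set V)) : Prop :=
  finite_set T /\ polytopal_cover W T.

Definition restrict_tess (W : set V) (T : set (set V)) : set (set V) :=
  [set C `&` W | C in T `&` [set C | (C `&` W)° !=set0]].

Definition tess_boundary (T : set (set V)) : set V :=
  \bigcup_(C in T) (closure C `\` C°).

(* Nonempty closed subsets of D.  As a subset of [fell V] it carries the induced
   topology; for closed D this is the Fell topology of the space D, since
   F `&` K = F `&` (K `&` D) and F `&` G = F `&` (G `&` D) for F `<=` D. *)
Definition closed_in (D : set V) : set (fell V) :=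
  [set F : fell V | (F : set V) !=set0 /\ (F : set V) `<=` D].

Definition cells (D : set V) (F : fell (closed_in D)) : set (set V) :=
  [set (val C : set V) | C in (F : set (closed_in D))].

(* [cells] embeds the closed subsets of the space of nonempty closed subsets of
   D into [set (set V)], and its range contains the tessellations of D.  A set
   of tessellations is measurable when it is Borel for the Fell topology
   through this embedding. *)
Definition borel_tess (D : set V) : set (set (set (set V))) :=
  [set B | measurable
     ((@cells D @^-1` B) : set (borelType (fell (closed_in D))))].

Definition tessType (D : set V) := g_sigma_algebraType (borel_tess D).
HB.instance Definition _ (D : set V) := Measurable.on (tessType D).

Definition is_hyperplane (H : set V) : Prop :=
  exists u r, u != 0 /\ H = [set x | dot u x = r].

Definition hyperplane : Type :=
  set_type [set F : fell V | is_hyperplane F].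

HB.instance Definition _ := Topological.on hyperplane.

Definition plane (H : hyperplane) : set V := fell_set (val H).

Lemma closed_coord_plane : closed [set x : V | dot (delta_mx ord0 ord0) x = 0].
Proof.
have -> : [set x : V | dot (delta_mx ord0 ord0) x = 0] =
          (fun x : V => x ord0 ord0) @^-1` [set 0 : R].
  apply/seteqP; split => x /=; rewrite /dot (bigD1 ord0)//= big1 ?mxE ?eqxx.
  - by rewrite mul1r addr0.
  - by move=> i i0; rewrite !mxE (negbTE i0) andbF mul0r.
  - by rewrite mul1r addr0.
  - by move=> i i0; rewrite !mxE (negbTE i0) andbF mul0r.
apply: preimage_closed; last by apply: accessible_closed_set1; exact: hausdorff_accessible.
by move=> x _; exact: coord_continuous.
Qed.

Lemma coord_plane_hyperplane :
  Fell closed_coord_plane \in [set F : fell V | is_hyperplane F].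
Proof.
rewrite inE /=; exists (delta_mx ord0 ord0), 0; split => //.
by apply/eqP => /matrixP/(_ ord0 ord0); rewrite !mxE eqxx => /eqP; rewrite oner_eq0.
Qed.

HB.instance Definition _ :=
  isPointed.Build hyperplane
    (exist (fun F => F \in [set F : fell V | is_hyperplane F])
       (Fell closed_coord_plane) coord_plane_hyperplane).

Definition hits (B : set V) : set (borelType hyperplane) :=
  [set H : hyperplane | plane H `&` B !=set0].

Section DrivingMeasure.
Variable Lambda : {measure set (borelType hyperplane) -> \bar R}.

Definition translate_planes (x : V) (S : set (borelType hyperplane)) :
    set (borelType hyperplane) :=
  [set H : hyperplane |
    exists2 H0 : hyperplane, S H0 & plane H = [set y + x | y in plane H0]].

Definition translation_invariant : Prop :=
  forall (x : V) S, measurable S -> Lambda (translate_planes x S) = Lambda S.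

Definition meas_support : set hyperplane :=
  [set H | forall U : set hyperplane, open U -> U H -> (0 < Lambda U)%E].

Definition parallel (v : V) (H : hyperplane) : Prop :=
  forall x (s : R), plane H x -> plane H (x + s *: v).

(* Finiteness of [hits W] does not follow from the other clauses: a translation
   invariant measure with an infinite sigma-finite measure of directions is
   still sigma-finite. *)
Definition driving_measure : Prop :=
  [/\ (0 < Lambda setT)%E,
      sigma_finite setT Lambda,
      translation_invariant,
      ~ (exists v : V, v != 0 /\ forall H, meas_support H -> parallel v H) &
      forall W, polytope W -> (Lambda (hits W) < +oo)%E].

(* Lambda_C = Lambda([C])^-1 Lambda(. `&` [C]) *)
Definition cond_measure (C : set V) (S : set (borelType hyperplane)) : \bar R :=
  (((fine (Lambda (hits C)))^-1)%:E * Lambda (S `&` hits C))%E.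

(* Law of the pair (lifetime of C, hyperplane dividing C). *)
Definition cell_law (C : set V) (B : set R) (S : set (borelType hyperplane)) :
    \bar R :=
  (exponential_prob (fine (Lambda (hits C))) B * cond_measure C S)%E.

(* Which of the two pieces is named C1 is immaterial: (u, r) may be replaced by
   (- u, - r). *)
Definition divides (H C C1 C2 : set V) : Prop :=
  exists u r, [/\ u != 0, H = [set x | dot u x = r],
    C1 = C `&` [set x | dot u x <= r] & C2 = C `&` [set x | r <= dot u x]].

Section Genealogy.
Context (d : measure_display) (Omega : measurableType d).
Variables (tau : seq bool -> Omega -> R)
  (H : seq bool -> Omega -> hyperplane) (C : seq bool -> Omega -> fell V).

(* The cells are indexed by the nodes of the infinite binary tree: the node v is
   the list of turns from the root, so its ancestors are the [take i v], and its
   two children are [rcons v false] and [rcons v true].  The cell C v is born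
   when its parent dies, lives for the time tau v, and is divided by H v. *)
Definition birth (v : seq bool) (w : Omega) : R :=
  \sum_(i < size v) tau (take i v) w.

Definition present (t : R) (w : Omega) : set (seq bool) :=
  [set v | birth v w <= t < birth v w + tau v w].

Definition present_cells (t : R) (w : Omega) : set (set V) :=
  [set (C v w : set V) | v in present t w].

(* Lifetimes and hyperplanes of the generations < n, cells of the generations
   <= n. *)
Definition past (n : nat) : set (set Omega) :=
  <<s \bigcup_(v in [set v : seq bool | (size v < n)%N])
        (preimage_set_system setT (tau v) (@measurable _ R) `|`
         preimage_set_system setT (H v)
           (@measurable _ (borelType hyperplane))) `|`
      \bigcup_(v in [set v : seq bool | (size v <= n)%N])
        preimage_set_system setT (C v) (@measurable _ (borelType (fell V))) >>.

(* Given [past n], the pairs (tau v, H v) for v in generation n are independent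
   with laws [cell_law (C v)]. *)
Definition generation_law (P : probability Omega R) : Prop :=
  forall n A (B : n.-tuple bool -> set R)
    (S : n.-tuple bool -> set (borelType hyperplane)),
    past n A -> (forall v, measurable (B v)) -> (forall v, measurable (S v)) ->
    P (A `&` \bigcap_(v in [set: n.-tuple bool])
               (tau v @^-1` B v `&` H v @^-1` S v)) =
    (\int[P]_(w in A) \prod_(v : n.-tuple bool) cell_law (C v w) (B v) (S v))%E.

End Genealogy.

(* X is a version of Y /\ W = (Y_t /\ W : t >= 0).  The requirement on [birth]
   is that of finitely many jumps on bounded time intervals, which makes the
   paths pure jump and cadlag. *)
Definition window_stit (W : set V) (d : measure_display)
    (Omega : measurableType d) (P : probability Omega R)
    (X : R -> Omega -> set (set V)) : Prop :=
  exists (tau : seq bool -> Omega -> R) (H : seq bool -> Omega -> hyperplane)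
    (C : seq bool -> Omega -> fell V),
  [/\ forall v,
        [/\ measurable_fun setT (tau v),
            measurable_fun setT (H v : Omega -> borelType hyperplane) &
            measurable_fun setT (C v : Omega -> borelType (fell V))],
      forall w, (C [::] w : set V) = W /\
        forall v, 0 < tau v w /\
          divides (plane (H v w)) (C v w) (C (rcons v false) w)
            (C (rcons v true) w),
      generation_law tau H C P,
      forall w (t : R), finite_set [set v | birth tau v w <= t] &
      forall w (t : R), 0 <= t ->
        X t w = present_cells tau C t w /\ window_tessellation W (X t w)].

Definition markov_process (d : measure_display) (Omega : measurableType d)
    (P : probability Omega R) (Y : R -> Omega -> set (set V)) : Prop :=
  forall (s t : R) (B : set (tessType setT)), 0 < s -> s < t -> measurable B ->
  exists g : tessType setT -> \bar R,
    [/\ measurable_fun setT g, forall T, (0 <= g T)%E &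
        forall A : set Omega,
          <<s \bigcup_(r in [set r : R | 0 < r <= s])
                preimage_set_system setT (Y r)
                  (@measurable _ (tessType setT)) >> A ->
          P (A `&` Y t @^-1` B) = (\int[P]_(w in A) g (Y s w))%E].

(* Equality in law of processes is equality of the finite dimensional
   distributions. *)
Definition stit (d : measure_display) (Omega : measurableType d)
    (P : probability Omega R) (Y : R -> Omega -> set (set V)) : Prop :=
  [/\ forall t : R, 0 < t ->
        measurable_fun setT (Y t : Omega -> tessType setT) /\
        forall w, tessellation (Y t w),
      markov_process P Y &
      forall W, polytope W ->
        exists (d' : measure_display) (Omega' : measurableType d')
          (P' : probability Omega' R) (X : R -> Omega' -> set (set V)),
          window_stit W P' X /\
          forall n (t : 'I_n -> R) (B : 'I_n -> set (tessType W)),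
            (forall i, 0 < t i) -> (forall i, measurable (B i)) ->
            P (\bigcap_i ((fun w => restrict_tess W (Y (t i) w)) @^-1` B i)) =
            P' (\bigcap_i (X (t i) @^-1` B i))].

End DrivingMeasure.

Definition independent_copies (I : choiceType) (J : set I) (W : set V)
    (d : measure_display) (Omega : measurableType d) (P : probability Omega R)
    (X : I -> Omega -> set (set V))
    (d' : measure_display) (Omega' : measurableType d')
    (P' : probability Omega' R) (Z : Omega' -> set (set V)) : Prop :=
  [/\ forall k, J k -> measurable_fun setT (X k : Omega -> tessType W) /\
        forall w, window_tessellation W (X k w),
      forall k (B : set (tessType W)), J k -> measurable B ->
        P (X k @^-1` B) = P' (Z @^-1` B) &
      forall (s : seq I) (B : I -> set (tessType W)), uniq s ->
        [set` s] `<=` J -> (forall k, measurable (B k)) ->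
        P (\big[setI/setT]_(k <- s) (X k @^-1` B k)) =
        (\prod_(k <- s) P (X k @^-1` B k))%E].

End Geometry.

(* Main.v *)
Require Import Defs.
From HB Require Import structures.
From mathcomp Require Import all_boot all_order all_algebra.
From mathcomp Require Import all_classical all_reals all_analysis.
From mathcomp Require Import measurable_realfun.
From mathcomp Require finmap.
From mathcomp Require Import ring lra.

Set Implicit Arguments.
Unset Strict Implicit.
Unset Printing Implicit Defensive.

Import Order.TTheory GRing.Theory Num.Theory.
Import numFieldNormedType.Exports.

Local Open Scope classical_set_scope.
Local Open Scope ring_scope.

(** The boundary of [R^k] misses the interior of [Q = a^k W] iff some cell of
    [R^k] contains [Q].  By consistency this is the event that [Q] is undivided
    at time 1, of probability [exp (- Lambda [Q])].

    [Lambda [c W] = c Lambda [W]]: the hyperplanes through 0 are null, and every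
    other one is [u . x = 1] for some [u].  Sort these by the first vertex [p_j]
    of [W] maximizing [u . p_j]; those sorted to [p_j] that hit [(b + c) W] but
    not [b W] are the translates by [b p_j] of those sorted to [p_j] that hit
    [c W].  Hence [Lambda [c W]] is additive in [c], so linear.

    For the recurrence, let [q = prod_j beta_j > 0] be the probability of a run
    (success at all indices [m + j]) and [g_L = prod_(j < L) beta_j].  Disjoint
    blocks of length [L] are independent and complete with probability [g_L], so
    almost surely one is completed; the first completed block extends to a run
    with probability [q / g_L], which tends to 1 as [L] grows. *)

(** * Convex hulls and polytopes *)

Lemma convex_setP (R : realType) (M : lmodType R) (A : set M) :
  convex_set A <-> forall x y (t : R), A x -> A y -> 0 <= t -> t <= 1 ->
    A (t *: x + (1 - t) *: y).
Proof.
split=> [cA x y t Ax Ay t0 t1|cA x y t /set_mem Ax /set_mem Ay].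
  by have /set_mem := cA x y (Itv01 t0 t1) (mem_set Ax) (mem_set Ay).
by apply/mem_set; apply: cA.
Qed.

Section convex_normed.
Context (R : realType) (V : normedModType R).
Implicit Types (A : set V) (x y z : V).

(** The homothety [z |-> t *: x + (1 - t) *: z] carries a ball of radius [e] about [y] inside [A]
    onto the ball of radius [(1 - t) * e] about the combination. *)
Lemma interior_convex_comb A x y (t : R) : convex_set A -> A x -> A° y ->
  0 <= t -> t < 1 -> A° (t *: x + (1 - t) *: y).
Proof.
move=> /convex_setP cA Ax /nbhs_ballP[e /= e0 yA] t0 t1.
have s0 : 0 < 1 - t by rewrite subr_gt0.
apply/nbhs_ballP; exists ((1 - t) * e) => /=; first exact: mulr_gt0.
move=> z; rewrite -ball_normE /= => zb.
have -> : z = t *: x + (1 - t) *: ((1 - t)^-1 *: (z - t *: x)).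
  by rewrite scalerA mulfV ?gt_eqF// scale1r addrC subrK.
apply: cA => //; last exact: ltW.
apply: yA; rewrite -ball_normE /=.
rewrite -(ltr_pM2l s0) -[X in X * `|_|](gtr0_norm s0) -normrZ scalerBr scalerA.
by rewrite mulfV ?gt_eqF// scale1r opprB addrA [_ + t *: x]addrC.
Qed.

Lemma convex_sub_closure_interior A x y : convex_set A -> A° y -> A x ->
  closure A° x.
Proof.
move=> cA Ay Ax B /nbhs_ballP[e /= e0 xB].
(* The weight [s] of [y] is small enough that the combination stays within [e] of [x]; the [+ 1]
   keeps [d] positive when [x = y]. *)
pose d := `|x - y| + 1.
have d0 : 0 < d by rewrite ltr_wpDl.
pose s := Num.min 1 (e / d / 2).
have s0 : 0 < s by rewrite lt_min ltr01 !divr_gt0.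
have s1 : s <= 1 by rewrite ge_min lexx.
exists ((1 - s) *: x + (1 - (1 - s)) *: y); split.
  by apply: interior_convex_comb => //; rewrite ?subr_ge0// ltrBlDr ltrDl.
apply: xB; rewrite -ball_normE /=.
have -> : x - ((1 - s) *: x + (1 - (1 - s)) *: y) = s *: (x - y).
  rewrite subKr scalerBl scale1r scalerBr opprD opprB addrA addrCA subrr addr0.
  by [].
rewrite normrZ gtr0_norm//.
apply: (@le_lt_trans _ _ (e / d / 2 * d)).
  by apply: ler_pM => //; rewrite ?(ltW s0)// ?ge_min ?lexx ?orbT// lerDl.
rewrite mulrAC divfK ?gt_eqF// ltr_pdivrMr// ltr_pMr// ltr1n//.
Qed.

End convex_normed.

Section hull.
Context (R : realType) (l : nat).
Local Notation V := 'rV[R]_l.+1.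
Implicit Types (S K : set V) (p x y : V).

Lemma convex_hull_convex S : convex_set (convex_hull S).
Proof.
apply/convex_setP => x y t hx hy t0 t1 B [cB SB].
by move/convex_setP : (cB); apply => //; [apply: hx|apply: hy].
Qed.

Lemma sub_convex_hull S : S `<=` convex_hull S.
Proof. exact: sub_smallest. Qed.

Lemma convex_hull_sub S K : convex_set K -> S `<=` K -> convex_hull S `<=` K.
Proof. by move=> cK SK; exact: smallest_sub. Qed.

(** Written as a continuous image of [[0, 1]] times [K], so that compactness of [K] passes to the
    cone. *)
Definition cone_over p K : set V :=
  (fun z : R * V => z.1 *: p + (1 - z.1) *: z.2) @` (`[0, 1] `*` K).

Lemma cone_over_compact p K : compact K -> compact (cone_over p K).
Proof.
move=> cK; apply: continuous_compact; last first.
  by apply: compact_setX => //; exact: segment_compact.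
apply: continuous_subspaceT => z.
apply: cvgD; first by apply: cvgZ; [exact: cvg_fst|exact: cvg_cst].
apply: cvgZ; last exact: cvg_snd.
by apply: cvgB; [exact: cvg_cst|exact: cvg_fst].
Qed.

Lemma cone_over_convex p K : convex_set K -> convex_set (cone_over p K).
Proof.
move=> /convex_setP cK; apply/convex_setP => _ _ t [[a x] [/= a01 Kx] <-]
  [[b y] [/= b01 Ky] <-] t0 t1 /=.
move: a01 b01; rewrite !in_itv/= => /andP[a0 a1] /andP[b0 b1].
set c := t * a + (1 - t) * b.
have c01 : 0 <= c <= 1 by rewrite /c; nra.
have c'E : 1 - c = t * (1 - a) + (1 - t) * (1 - b) by rewrite /c; ring.
(* If [1 - c = 0], both weights on [K] vanish and the combination is [p], so any point of [K] will
   do. Otherwise the two points of [K] are combined with the normalized weight [s]. *)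
have [c'0|c'0] := eqVneq (1 - c) 0.
  exists (c, x); first by rewrite /= in_itv.
  have ea : t * (1 - a) = 0 by nra.
  have eb : (1 - t) * (1 - b) = 0 by nra.
  rewrite /= c'0 scale0r addr0 !scalerDr !scalerA ea eb !scale0r !addr0.
  by rewrite -scalerDl.
have c'p : 0 < 1 - c by lra.
pose s := t * (1 - a) / (1 - c).
have s0 : 0 <= s by rewrite /s divr_ge0//; nra.
have s1 : s <= 1 by rewrite /s ler_pdivrMr// mul1r c'E; nra.
exists (c, s *: x + (1 - s) *: y).
  by split; [rewrite /= in_itv|exact: cK].
have -> : t *: (a *: p + (1 - a) *: x) + (1 - t) *: (b *: p + (1 - b) *: y) =
  c *: p + ((t * (1 - a)) *: x + ((1 - t) * (1 - b)) *: y).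
  by rewrite !scalerDr !scalerA addrACA -scalerDl.
rewrite /= scalerDr !scalerA /s mulrBr mulr1.
rewrite mulrCA mulfV// mulr1; congr (_ + (_ + _ *: _)).
by rewrite mulrBr mulr1 mulrC divfK// c'E; ring.
Qed.

Lemma convex_hullU1 p S : S !=set0 ->
  convex_hull (p |` S) = cone_over p (convex_hull S).
Proof.
move=> [q Sq]; apply/seteqP; split.
  apply: convex_hull_sub.
    by apply: cone_over_convex; exact: convex_hull_convex.
  move=> x [->|Sx].
    exists (1, q).
      split; first by rewrite /= in_itv/= lexx ler01.
      exact: sub_convex_hull.
    by rewrite /= subrr scale0r scale1r addr0.
  exists (0, x).
    split; first by rewrite /= in_itv/= lexx ler01.
    exact: sub_convex_hull.
  by rewrite /= subr0 scale0r scale1r add0r.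
move=> _ [[t x] [/= + hx] <-]; rewrite in_itv/= => /andP[t0 t1].
have /convex_setP := @convex_hull_convex (p |` S); apply => //.
  by apply: sub_convex_hull; left.
move: x hx; apply: convex_hull_sub; first exact: convex_hull_convex.
by move=> y Sy; apply: sub_convex_hull; right.
Qed.

(** Adding one point to a nonempty finite set replaces its hull by a cone over it, which stays
    compact. *)
Lemma convex_hull_compact S : finite_set S -> compact (convex_hull S).
Proof.
move=> /finite_seqP[s ->]; elim: s => [|p s IH].
  have -> : convex_hull [set` ([::] : seq V)] = set0.
    by rewrite -subset0; apply: convex_hull_sub.
  exact: compact0.
have -> : [set` p :: s] = p |` [set` s].
  apply/seteqP; split => x /=; rewrite inE.
    by move=> /predU1P.
  by move/predU1P.
have [->|/set0P s0] := eqVneq [set` s] set0.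
  rewrite setU0; have -> : convex_hull [set p] = [set p].
    apply/seteqP; split; last exact: sub_convex_hull.
    apply: convex_hull_sub => //.
    apply/convex_setP => _ _ t -> -> _ _ /=.
    by rewrite -scalerDl addrCA subrr addr0 scale1r.
  exact: compact_set1.
by rewrite convex_hullU1//; exact: cone_over_compact.
Qed.

Lemma polytope_convex K : polytope K -> convex_set K.
Proof. by move=> [[S _ ->] _]; exact: convex_hull_convex. Qed.

Lemma polytope_compact K : polytope K -> compact K.
Proof. by move=> [[S fS ->] _]; exact: convex_hull_compact. Qed.

Lemma polytope_closed K : polytope K -> closed K.
Proof.
by move=> /polytope_compact; apply: compact_closed; exact: norm_hausdorff.
Qed.

Lemma dilateE (c : R) K : c != 0 -> dilate c K = ( *:%R c^-1) @^-1` K.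
Proof.
move=> c0; apply/seteqP; split => [_ [x Kx <-]|x Kx] /=.
  by rewrite scalerA mulVf// scale1r.
by exists (c^-1 *: x) => //; rewrite scalerA mulfV// scale1r.
Qed.

Lemma dilateK (c : R) K : c != 0 -> dilate c^-1 (dilate c K) = K.
Proof.
move=> c0; rewrite !dilateE ?invr_eq0// invrK.
by apply/seteqP; split => x /=; rewrite scalerA mulVf// scale1r.
Qed.

Lemma dilate_interior0 (c : R) K : c != 0 -> K° 0 -> (dilate c K)° 0.
Proof.
move=> c0 K0; rewrite dilateE//; rewrite /interior /=.
have /(_ 0) h : continuous ( *:%R c^-1 : V -> V) by exact: scaler_continuous.
by apply: h; rewrite scaler0.
Qed.

Lemma dilate_hull (c : R) S : c != 0 ->
  dilate c (convex_hull S) = convex_hull (dilate c S).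
Proof.
move=> c0.
(* This inclusion, used with [c^-1] on [dilate c S], also yields the reverse one. *)
have sub (b : R) (T : set V) :
    dilate b (convex_hull T) `<=` convex_hull (dilate b T).
  move=> _ [x hx <-] B [cB SB].
  suff : convex_hull T `<=` [set z | B (b *: z)] by exact.
  apply: convex_hull_sub; last by move=> z Tz; apply: SB; exists z.
  apply/convex_setP => y z t /= By Bz t0 t1.
  rewrite scalerDr !scalerA [b * t]mulrC [b * _]mulrC -!scalerA.
  by move/convex_setP : cB; exact.
apply/seteqP; split; first exact: sub.
move=> x hx; have := @sub c^-1 (dilate c S) (c^-1 *: x).
by rewrite dilateK// [in X in _ -> X]dilateE//; apply; exists x.
Qed.

Lemma dilate_polytope (c : R) K : c != 0 -> K° 0 -> polytope K ->
  polytope (dilate c K).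
Proof.
move=> c0 K0 [[S fS KE] _]; split; last by exists 0; exact: dilate_interior0.
exists (dilate c S); first exact: finite_image.
by rewrite KE dilate_hull.
Qed.

Lemma dilate_sub (b c : R) K : convex_set K -> K 0 -> 0 <= b -> b <= c ->
  dilate b K `<=` dilate c K.
Proof.
move=> /convex_setP cK K0 b0 bc _ [x Kx <-].
have [c0|c0] := eqVneq c 0.
  have -> : b = 0 by apply/eqP; rewrite eq_le b0 -c0 bc.
  by exists 0 => //; rewrite scale0r scaler0.
have cp : 0 < c by rewrite lt_neqAle eq_sym c0 (le_trans b0).
exists ((b / c) *: x + (1 - b / c) *: 0).
  by apply: cK => //; [exact: divr_ge0 (ltW cp)|rewrite ler_pdivrMr// mul1r].
by rewrite scaler0 addr0 scalerA mulrCA mulfV// mulr1.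
Qed.

Lemma dilate1 K : dilate 1 K = K.
Proof.
rewrite dilateE// ?oner_eq0// invr1.
by apply/seteqP; split => x /=; rewrite scale1r.
Qed.

End hull.

(** * Measurability in the Fell topology *)

Section fell_topology.
Context (E : topologicalType).
Implicit Types (K G Q : set E) (F : fell E).

Lemma fell_miss_open K : compact K -> open (@fell_miss E K).
Proof.
move=> cK; exists [set fell_miss K]; last by rewrite bigcup_set1.
by move=> _ ->; apply: finI_from1 => /=; left; exists K.
Qed.

Lemma fell_hit_open G : open G -> open (@fell_hit E G).
Proof.
move=> oG; exists [set fell_hit G]; last by rewrite bigcup_set1.
by move=> _ ->; apply: finI_from1 => /=; right; exists G.
Qed.

(** A neighbourhood of [F] contains a finite intersection of subbasic sets around [F], and a filter
    is stable under such intersections. *)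
Lemma fell_cvg (U : set_system (fell E)) F : Filter U ->
  (forall K, compact K -> fell_miss K F -> U (fell_miss K)) ->
  (forall G, open G -> fell_hit G F -> U (fell_hit G)) -> U --> F.
Proof.
move=> FU miss hit A; rewrite nbhsE => -[_ [[B sB <-] [C BC CF]] sUA].
rewrite nbhs_filterE; apply: filterS sUA _; apply: (@filterS _ _ _ C).
  by move=> ? ?; exists C.
have [D sD IDeC] := sB _ BC; rewrite -IDeC; apply: filter_bigI => S DS.
have FS : S F by move: CF; rewrite -IDeC => /(_ _ DS).
have /set_mem[[K cK eS]|[G oG eS]] := sD _ DS; rewrite -eS in FS *.
  exact: miss.
exact: hit.
Qed.

End fell_topology.

Section fell_compactness.
Import finmap.

Lemma compact_fell_sup (E : ptopologicalType) (Q : set E) :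
  compact [set F : fell E | Q `<=` F].
Proof.
rewrite compact_ultra => U UU UQ.
(* The limit of the ultrafilter: the points all of whose open neighbourhoods are hit by [U]-most
   closed sets. *)
pose L := [set x | forall G, open G -> G x -> U (fell_hit G)].
have cL : closed L.
  move=> x clx G oG Gx; have [y [Ly Gy]] := clx G (open_nbhs_nbhs (conj oG Gx)).
  exact: Ly.
exists (Fell cL); split=> /=.
  move=> x Qx G oG Gx; apply: filterS UQ => F QF.
  by exists x; split => //; exact: QF.
apply: fell_cvg.
  move=> K; rewrite compact_cover => cK LK.
  (* Each point of [K] lies outside [L], so it has an open neighbourhood missed by [U]-most closed
     sets; finitely many of these cover [K]. *)
  have nL x : K x -> exists G, [/\ open G, G x & U (~` fell_hit G)].
    move=> Kx; have /existsNP[G /not_implyP[oG /not_implyP[Gx nU]]] : ~ L x.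
      by move=> Lx; have : set0 x by rewrite -LK.
    by exists G; split=> //; have [] := in_ultra_setVsetC (fell_hit G) UU.
  pose g x := if pselect (K x) is left Kx then sval (cid (nL x Kx)) else set0.
  have gP x : K x -> [/\ open (g x), g x x & U (~` fell_hit (g x))].
    by rewrite /g; case: pselect => // Kx _; exact: svalP (cid (nL x Kx)).
  have [||D DK Kg] := cK _ K g.
  - by move=> x /gP[].
  - by move=> x Kx; exists x => //; have [] := gP _ Kx.
  have : U (\bigcap_(x in [set` D]) ~` fell_hit (g x)).
    by apply: filter_bigI => x /DK/set_mem/gP[].
  apply: filterS => F hF; rewrite /fell_miss /= -subset0.
  move=> x [Fx /Kg[y Dy gyx]].
  by apply: (hF _ Dy); exists x.
by move=> G oG [x [Lx Gx]]; exact: Lx.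
Qed.

End fell_compactness.

Lemma compact_set_type (T : topologicalType) (S A : set T) :
  A `<=` S -> compact A -> compact (set_val @^-1` A : set S).
Proof.
move=> AS cA U PU UA.
have [p [Ap clp]] := cA ((set_val : S -> T) @ U) _ UA.
exists (SigSub (mem_set (AS _ Ap))); split=> // M N UM [_ [[B oB <-] /= Bp] BN].
have [_ [[x Mx <-] Bx]] : (set_val @` M) `&` B !=set0.
  apply: clp; last exact: open_nbhs_nbhs.
  by apply: (@filterS _ U _ M) => // x Mx; exists x.
by exists x; split => //; exact: BN.
Qed.

Section measurable_tess.
Context (R : realType) (l : nat).
Local Notation V := 'rV[R]_l.+1.

Definition some_cell_contains (Q : set V) : set (set (set V)) :=
  [set T | exists2 C, T C & Q `<=` C].

(* The closed sets containing [Q] form a compact set, and hitting a compact set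
   is a closed condition. *)
Lemma measurable_some_cell_contains (D Q : set V) : closed D -> Q !=set0 ->
  Q `<=` D -> measurable (some_cell_contains Q : set (tessType D)).
Proof.
move=> cD Q0 QD; apply: sub_sigma_algebra; rewrite /borel_tess /=.
pose A := [set F : fell V | Q `<=` F] `&` ~` fell_hit (~` D).
have AE : A `<=` closed_in D.
  move=> F [QF FD]; split.
    by have [x Qx] := Q0; exists x; exact: QF.
  by move=> x Fx; apply: contrapT => Dx; apply: FD; exists x.
have cA : compact A.
  apply: compact_closedI; first exact: compact_fell_sup.
  by apply: open_closedC; apply: fell_hit_open; exact: closed_openC.
suff -> : @cells R l D @^-1` some_cell_contains Q =
    ~` fell_miss (set_val @^-1` A : set (closed_in D)).
  apply: measurableC; apply: sub_sigma_algebra; apply: fell_miss_open.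
  exact: compact_set_type.
apply/seteqP; split=> [F [_ [C FC <-] QC] hF|F].
  have : set0 C; last by [].
  rewrite -hF; split=> //; split=> // -[x [Cx]]; apply.
  by have /set_mem[_] := valP C; exact.
move=> /eqP/set0P[C [FC [QC _]]].
by exists (val C) => //; exists C.
Qed.

Lemma measurable_hits (K : set V) : compact K -> measurable (@hits R l K).
Proof.
move=> cK; have -> : @hits R l K =
    ~` ((set_val : hyperplane R l -> fell V) @^-1` fell_miss K).
  apply/seteqP; split=> H /=; rewrite /hits /fell_miss/=.
      by move/set0P/eqP.
    by move/eqP/set0P.
apply: measurableC; apply: sub_sigma_algebra.
exists (fell_miss K) => //; exact: fell_miss_open.
Qed.

End measurable_tess.

(** * Cells of a tessellation of a window *)

Section tessellation_cells.
Context (R : realType) (l : nat).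
Local Notation V := 'rV[R]_l.+1.
Implicit Types (T : set (set V)) (W Q C D : set V).

(** Near a boundary point of the convex cell [D] there are interior points of [D]; were that point
    interior to [C], the two interiors would meet. *)
Lemma cell_boundary_disjoint T C D : T `<=` @polytope R l ->
  trivIset T (@interior V) -> T C -> T D ->
  (closure D `\` D°) `&` C° = set0.
Proof.
move=> Tp tT TC TD; rewrite -subset0 => x [[clDx nDx] Cx].
have [eCD|neCD] := pselect (C = D); first by apply: nDx; rewrite -eCD.
have pD := Tp _ TD; have [y Dy] := pD.2.
have Dx : D x by apply: (polytope_closed pD).
have [z [Dz Cz]] := convex_sub_closure_interior (polytope_convex pD) Dy Dx
  (open_nbhs_nbhs (conj (@open_interior _ C) Cx)).
by apply: neCD; apply: tT => //; exists z.
Qed.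

(** Starting in a cell that contains 0, a segment inside [Q°] cannot leave it without crossing its
    boundary; [Q] follows as part of the closure of [Q°]. The converse is the disjointness of cell
    interiors from cell boundaries. *)
Lemma tess_boundary_misses W T Q : window_tessellation W T ->
  convex_set Q -> Q° 0 -> Q `<=` W ->
  tess_boundary T `&` Q° = set0 <-> some_cell_contains Q T.
Proof.
move=> [_ [Tp tT TW]] cQ Q0 QW; split; last first.
  move=> [C TC QC]; rewrite -subset0 => x [[D TD bDx] Qx].
  rewrite -(cell_boundary_disjoint Tp tT TC TD); split=> //.
  by move: Qx; exact: interiorS.
move=> bTQ.
have cell_int C x : T C -> closure C x -> Q° x -> C° x.
  move=> TC clCx Qx; apply: contrapT => nCx.
  by have : set0 x by rewrite -bTQ; split=> //; exists C.
have [C TC C0] : exists2 C, T C & C 0.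
  have : W 0 by apply: QW; exact: interior_subset.
  by rewrite -TW => -[C TC C0]; exists C.
have clC := polytope_closed (Tp _ TC).
exists C => // x Qx.
suff QC : Q° `<=` C.
  by apply: clC; apply: closureS QC _ (convex_sub_closure_interior cQ Q0 Qx).
move=> {x Qx} y Qy; pose f (t : R) : V := t *: y.
pose I := f @` `[0, 1].
have IQ : I `<=` Q°.
  move=> _ [t /= + <-]; rewrite in_itv/= => /andP[t0 t1].
  have [->|nt1] := eqVneq t 1; first by rewrite /f scale1r.
  have -> : f t = t *: y + (1 - t) *: 0 by rewrite scaler0 addr0.
  apply: interior_convex_comb => //; first exact: interior_subset.
  by rewrite lt_neqAle nt1.
have cI : connected I.
  apply: connected_continuous_connected; first exact: segment_connected.
  apply: continuous_subspaceT => t.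
  by apply: cvgZ; [exact: cvg_id|exact: cvg_cst].
(* The trace of [C] on the connected set [I] is nonempty, relatively open (it equals that of [C°])
   and relatively closed. *)
have IC : I `&` C = I.
  apply: cI.
  - exists 0; split=> //; exists 0; rewrite /f ?scale0r//=.
    by rewrite in_itv/= lexx ler01.
  - exists C°; first exact: open_interior.
    apply/seteqP; split=> x [Ix Cx]; split=> //; last exact: interior_subset.
    by apply: cell_int => //; [exact: subset_closure|exact: IQ].
  - by exists C.
have : I y by exists 1; rewrite /f ?scale1r//= in_itv/= ler01 lexx.
by rewrite -IC => -[].
Qed.

(** Restriction discards only cells whose trace on [W] has empty interior, and such a trace cannot
    contain [Q]. *)
Lemma restrict_some_cell_contains W Q T : Q° !=set0 -> Q `<=` W ->
  some_cell_contains Q (restrict_tess W T) <-> some_cell_contains Q T.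
Proof.
move=> [x Qx] QW; split=> [[_ [C [TC _] <-]]|[C TC QC]].
  by rewrite subsetI => -[QC _]; exists C.
have QCW : Q `<=` C `&` W by rewrite subsetI.
exists (C `&` W) => //; exists C => //; split=> //.
by exists x; exact: interiorS Qx.
Qed.

End tessellation_cells.

(** * The first division of a window *)

Section dot_product.
Context (R : realType) (l : nat).
Local Notation V := 'rV[R]_l.+1.
Implicit Types (u x y : V) (r s : R).

Lemma dotC u x : dot u x = dot x u.
Proof. by apply: eq_bigr => i _; rewrite mulrC. Qed.

Lemma dotDr u x y : dot u (x + y) = dot u x + dot u y.
Proof. by rewrite -big_split; apply: eq_bigr => i _; rewrite mxE mulrDr. Qed.

Lemma dotZr u s x : dot u (s *: x) = s * dot u x.
Proof. by rewrite mulr_sumr; apply: eq_bigr => i _; rewrite mxE mulrCA. Qed.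

Lemma dotZl u s x : dot (s *: u) x = s * dot u x.
Proof. by rewrite dotC dotZr dotC. Qed.

Lemma dot0r u : dot u 0 = 0.
Proof. by rewrite -(scale0r 0) dotZr mul0r. Qed.

Lemma dotBr u x y : dot u (x - y) = dot u x - dot u y.
Proof. by rewrite -scaleN1r dotDr dotZr mulN1r. Qed.

Lemma dot_gt0 u : u != 0 -> 0 < dot u u.
Proof.
move=> u0; rewrite lt_neqAle sumr_ge0 ?andbT; last first.
  by move=> i _; rewrite -expr2 sqr_ge0.
rewrite eq_sym; apply: contra_neq u0 => uu0.
apply/rowP => i; rewrite mxE.
have /eqP := uu0; rewrite psumr_eq0; last by move=> j _; rewrite -expr2 sqr_ge0.
by move=> /allP/(_ i (mem_index_enum _))/=; rewrite mulf_eq0 orbb => /eqP.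
Qed.

Lemma dot_continuous u : continuous (dot u : V -> R).
Proof.
move=> x; apply: (@cvg_big _ _ _ _ _ _ _ (nbhs x)) => [|i _].
  exact: add_continuous.
by apply: cvgM; [exact: cvg_cst|exact: coord_continuous].
Qed.

Lemma closed_dot_eq u r : closed [set x | dot u x = r].
Proof.
have -> : [set x | dot u x = r] = dot u @^-1` [set r] by [].
apply: preimage_closed; last first.
  by apply: accessible_closed_set1; exact: hausdorff_accessible.
by move=> x _; exact: dot_continuous.
Qed.

(** Moving from a point in the direction [u] strictly increases [dot u], so it leaves the level set
    at once. *)
Lemma interior_dot_eq u r (D : set V) : u != 0 ->
  D `<=` [set x | dot u x = r] -> D° = set0.
Proof.
move=> u0 Dr; rewrite -subset0 => x Dx.
have uu := dot_gt0 u0.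
have : \forall s \near (0 : R)^'+, D (x + s *: u).
  suff /(_ D Dx) : x + s *: u @[s --> (0 : R)^'+] --> x by [].
  apply: cvg_at_right_filter.
  rewrite -[X in _ --> X]addr0 -[X in _ + X](scale0r u).
  apply: cvgD; first exact: cvg_cst.
  by apply: cvgZ; [exact: cvg_id|exact: cvg_cst].
move=> nD; have [s [/= s0]] : exists s, 0 < s /\ D (x + s *: u).
  near (0 : R)^'+ => s; exists s; split; near: s => //.
  exact: nbhs_right_gt.
move=> /Dr/=; rewrite dotDr dotZr (Dr _ (interior_subset Dx)) => /eqP.
by rewrite -subr_eq0 addrAC subrr add0r mulf_eq0 !gt_eqF.
Unshelve. all: by end_near. Qed.

End dot_product.

(** * The lifetime of the initial cell *)

Section first_division.
Context (R : realType) (l : nat).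
Local Notation V := 'rV[R]_l.+1.
Context (Lambda : {measure set (borelType (hyperplane R l)) -> \bar R}).
Context (d : measure_display) (Omega : measurableType d).
Context (P : probability Omega R).
Implicit Types (tau : seq bool -> Omega -> R)
  (H : seq bool -> Omega -> hyperplane R l) (C : seq bool -> Omega -> fell V).

Lemma child_cell_sub (Hs C0 C1 C2 : set V) : divides Hs C0 C1 C2 ->
  C1 `<=` C0 /\ C2 `<=` C0.
Proof. by move=> [u [r [_ _ -> ->]]]; split; exact: subIsetl. Qed.

(** If one piece were everything, the other would lie in the dividing hyperplane and have empty
    interior. *)
Lemma divides_interior (Hs C0 C1 C2 : set V) : divides Hs C0 C1 C2 ->
  C1° !=set0 -> C2° !=set0 -> ~ C0 `<=` C1 /\ ~ C0 `<=` C2.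
Proof.
move=> [u [r [u0 _ -> ->]]] [x1 C1x1] [x2 C2x2]; split => sub.
  move: C2x2; rewrite (@interior_dot_eq _ _ u r)// => z [Cz rz].
  by apply/eqP; rewrite eq_le rz andbT; have [] := sub _ Cz.
move: C1x1; rewrite (@interior_dot_eq _ _ u r)// => z [Cz rz].
by apply/eqP; rewrite eq_le rz /=; have [] := sub _ Cz.
Qed.

(** Generation 0 consists of the root alone, whose cell is always [W], so the integrand of the
    generation law is constant. *)
Lemma first_lifetime_law W tau H C (D : set R) :
  (forall w, (C [::] w : set V) = W) -> generation_law Lambda tau H C P ->
  measurable D ->
  P (tau [::] @^-1` D) = cell_law Lambda W D setT.
Proof.
move=> C0 /(_ 0%N setT (fun=> D) (fun=> setT)).
rewrite setTI => law mD.
have -> : tau [::] @^-1` D = \bigcap_(v in [set: 0.-tuple bool])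
    (tau v @^-1` D `&` H v @^-1` setT).
  apply/seteqP; split=> [w Dw v _|w /(_ [tuple] I)[]//].
  by split=> //; rewrite (tuple0 v).
rewrite law//; last exact: (@measurableT _ (g_sigma_algebraType _)).
under eq_integral => w _.
  rewrite (bigD1 [tuple])//= big1 ?mule1 ?C0; last first.
    by move=> v /eqP; rewrite (tuple0 v).
  over.
rewrite integral_cst//.
rewrite -[RHS]mule1; congr (_ * _)%E; exact: probability_setT.
Qed.

Lemma fine_hits (W : set V) : driving_measure Lambda -> polytope W ->
  (fine (Lambda (hits W)))%:E = Lambda (hits W).
Proof.
move=> [_ _ _ _ fin] pW; rewrite fineK// ge0_fin_numE ?measure_ge0//.
exact: fin.
Qed.

Lemma no_division_prob (W : set V) (X : R -> Omega -> set (set V)) (t : R) :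
  driving_measure Lambda -> polytope W -> 0 < t ->
  window_stit Lambda W P X ->
  P (X t @^-1` some_cell_contains W) =
  (expR (- (t * fine (Lambda (hits W)))))%:E.
Proof.
move=> dL pW t0 [tau [H [C [mC CW law _ XC]]]].
have C0 w : (C [::] w : set V) = W by have [] := CW w.
have divC v w : divides (plane (H v w)) (C v w) (C (rcons v false) w)
    (C (rcons v true) w) by have [_ /(_ v)[]] := CW w.
have tau0 v w : 0 < tau v w by have [_ /(_ v)[]] := CW w.
have birth1 b w : birth tau [:: b] w = tau [::] w.
  by rewrite /birth big_ord_recl big_ord0 addr0.
have sub_first b v w : (C (b :: v) w : set V) `<=` C [:: b] w.
  elim/last_ind: v => // v c IH; rewrite -rcons_cons.
  apply: subset_trans IH.
  by have [] := child_cell_sub (divC (b :: v) w); case: c.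
(* [W] lies in a cell at time [t] exactly when the root outlives [t], since all later cells are
   contained in one of the two children of the root. *)
have XE : X t @^-1` some_cell_contains W = ~` (tau [::] @^-1` `[0, t]).
  apply/seteqP; split=> w /=; rewrite in_itv/= ltW//=.
    have [-> _] := XC w t (ltW t0) => -[_ [v pv <-] Wv] taut.
    case: v pv Wv => [|b v] /=.
      rewrite /present/= /birth big_ord0 add0r => /andP[_].
      by rewrite ltNge taut.
    move=> _ /subset_trans/(_ (sub_first b v w)) Wb.
    (* At the death time of the root both children are present, hence they are polytopes with
       interior points and neither contains [W]. *)
    have [XE [_ [Xp _ _]]] := XC w (tau [::] w) (ltW (tau0 _ _)).
    have Ci c : (C [:: c] w : set V)° !=set0.
      have [_] : polytope (C [:: c] w); last by [].
      apply: Xp; rewrite XE; exists [:: c] => //.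
      by rewrite /present/= birth1 lexx ltrDl tau0.
    have := divides_interior (divC [::] w) (Ci false) (Ci true).
    by rewrite C0 /= => -[nf nt]; case: b Wb.
  move=> /negP; rewrite -ltNge => ttau.
  have [-> _] := XC w t (ltW t0).
  exists (C [::] w); last by rewrite C0.
  exists [::] => //.
  by rewrite /present/= /birth big_ord0 add0r ltW.
have [mtau _ _] := mC [::].
rewrite XE probability_setC; last first.
  by rewrite -[_ @^-1` _]setTI; exact: mtau.
(* With a vanishing rate [cell_law] would have total mass 0, while the root lifetime has a
   probability law. *)
have l0 : fine (Lambda (hits W)) != 0.
  apply/eqP => l0.
  have := first_lifetime_law C0 law measurableT.
  rewrite preimage_setT probability_setT /cell_law /cond_measure setTI.
  rewrite -fine_hits// l0 mule0 mule0 => /eqP.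
  by rewrite onee_eq0.
rewrite (first_lifetime_law C0 law)// /cell_law /cond_measure setTI.
rewrite -fine_hits//=.
rewrite -EFinM mulVf// mule1 exponential_prob_itv0c//=.
congr EFin.
by rewrite opprB addrC subrK mulNr mulrC.
Qed.

End first_division.

(** * Homogeneity of the driving measure *)

Section positive_additive.
Context (R : realType) (f : R -> R).
Hypothesis fD : forall s t, 0 < s -> 0 < t -> f (s + t) = f s + f t.
Hypothesis f_ge0 : forall s, 0 < s -> 0 <= f s.

Lemma additive_natmul n s : 0 < s -> f (s *+ n.+1) = f s *+ n.+1.
Proof.
move=> s0; elim: n => [|n IH]; first by rewrite !mulr1n.
by rewrite mulrS fD ?pmulrn_lgt0// IH -mulrS.
Qed.

Lemma additive_mono s t : 0 < s -> s <= t -> f s <= f t.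
Proof.
move=> s0; rewrite le_eqVlt => /predU1P[->//|st].
have ts0 : 0 < t - s by rewrite subr_gt0.
by rewrite -[t](subrK s) addrC fD// lerDl f_ge0.
Qed.

Lemma additive_linear c : 0 < c -> f c = c * f 1.
Proof.
move=> c0; have f1 := f_ge0 ltr01.
(* By the Archimedean property, an error whose multiples all stay below [f 1] is zero. *)
suff bound n : `|f c - c * f 1| * n.+1%:R <= f 1.
  apply/eqP; rewrite -subr_eq0 -normr_eq0; apply: contraT => e0.
  have ep : 0 < `|f c - c * f 1| by rewrite lt_neqAle eq_sym e0 /=.
  have := bound (Num.truncn (f 1 / `|f c - c * f 1|)).
  rewrite leNgt -ltr_pdivrMl// mulrC.
  by have /andP[_ ->] := truncn_itv (divr_ge0 f1 (ltW ep)).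
pose N := n.+1%:R : R; have N0 : 0 < N by rewrite ltr0n.
have cN0 : 0 <= c * N by rewrite mulr_ge0// ltW.
(* Monotonicity places [f (c * N)] between [m * f 1] and [(m + 1) * f 1]. The case [m = 0] is
   separate below because [f] is controlled only on positive arguments. *)
pose m := Num.truncn (c * N).
have /andP[mc cm] : (m%:R <= c * N < m.+1%:R) := truncn_itv cN0.
have fcN : f (c * N) = f c * N.
  by rewrite /N !mulr_natr additive_natmul.
have fnat k : f k.+1%:R = k.+1%:R * f 1.
  by rewrite additive_natmul// mulr_natl.
have up : f c * N <= m.+1%:R * f 1.
  by rewrite -fnat -fcN; apply: additive_mono; rewrite ?mulr_gt0// ltW.
have lo : m%:R * f 1 <= f c * N.
  case: (m) mc => [|k] mc; first by rewrite mul0r mulr_ge0 ?f_ge0 ?ltW.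
  by rewrite -fnat -fcN; apply: additive_mono.
rewrite -[X in _ * X]ger0_norm ?ler0n// -normrM mulrBl -/N ler_norml.
have -> : c * f 1 * N = c * N * f 1 by rewrite mulrAC.
have h1 := ler_wpM2r f1 mc.
have h2 := ler_wpM2r f1 (ltW cm).
move: up h2; rewrite -natr1 mulrDl mul1r => up h2.
apply/andP; split; lra.
Qed.

End positive_additive.

(** * Hyperplanes off the origin and their measurable description *)

Section hyperplanes.
Context (R : realType) (l : nat).
Local Notation V := 'rV[R]_l.+1.
Local Notation hyperplane := (hyperplane R l).
Local Notation hyp := (borelType (Defs.hyperplane R l)).
Implicit Types (u p q v x y : V) (H : hyperplane) (K S : set V) (r s t c : R).

Lemma planeP H : exists u r, u != 0 /\ plane H = [set x | dot u x = r].
Proof. by have /set_mem := valP H. Qed.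

Lemma plane_inj H1 H2 : plane H1 = plane H2 -> H1 = H2.
Proof.
rewrite /plane => e; apply: val_inj.
case: (val H1) (val H2) e => A cA [B cB] /= e.
by rewrite e in cA *; congr Fell; exact: Prop_irrelevance.
Qed.

Lemma dot_eq_norm u r : r != 0 ->
  [set x | dot u x = r] = [set x | dot (r^-1 *: u) x = 1].
Proof.
move=> r0; apply/seteqP; split=> x /=; rewrite dotZl.
  by move=> ->; rewrite mulVf.
by move/(congr1 ( *%R r)); rewrite mulrA mulfV// mul1r mulr1.
Qed.

Lemma plane_norm H : ~ plane H 0 -> exists u, plane H = [set x | dot u x = 1].
Proof.
have [u [r [u0 ->]]] := planeP H => /=; rewrite dot0r => /eqP r0.
by exists (r^-1 *: u); rewrite dot_eq_norm// eq_sym.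
Qed.

Lemma shift_planeE H v u r : plane H = [set x | dot u x = r] ->
  [set y + v | y in plane H] = [set x | dot u x = r + dot u v].
Proof.
move=> ->; apply/seteqP; split=> [_ [y /= <-] <-|x /= ux].
  by rewrite dotDr.
by exists (x - v); rewrite ?subrK//= dotBr ux addrK.
Qed.

Lemma shift_plane_exists H v : exists H', plane H' = [set y + v | y in plane H].
Proof.
have [u [r [u0 Hu]]] := planeP H.
have hP : Fell (@closed_dot_eq R l u (r + dot u v)) \in
    [set F : fell V | is_hyperplane F].
  by rewrite inE /=; exists u, (r + dot u v).
by exists (SigSub hP); rewrite (shift_planeE _ Hu).
Qed.

Lemma shift_planeK H v :
  [set y + v | y in [set y - v | y in plane H]] = plane H.
Proof.
apply/seteqP; split=> [_ [_ [x Hx <-] <-]|x Hx]; first by rewrite subrK.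
by exists (x - v); [exists x|rewrite subrK].
Qed.

(** Translation is invertible and a hyperplane is determined by its point set, so the preimage is
    unique. *)
Lemma translate_planesP v (S : set hyp) H H0 :
  plane H0 = [set y - v | y in plane H] -> translate_planes v S H <-> S H0.
Proof.
move=> eH; split=> [[H1 SH1 eH1]|SH0].
  have -> // : H0 = H1; apply: plane_inj; rewrite eH eH1.
  by have := shift_planeK H1 (- v); rewrite opprK.
by exists H0 => //; rewrite eH shift_planeK.
Qed.

Lemma hits1 x H : hits [set x] H <-> plane H x.
Proof.
by split=> [[_ [Hx <-]]//|Hx]; exists x.
Qed.

Definition segment0 q : set V := (fun t : R => t *: q) @` `[0, 1].

Lemma segment0_compact q : compact (segment0 q).
Proof.
apply: continuous_compact; last exact: segment_compact.
apply: continuous_subspaceT => t.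
by apply: cvgZ; [exact: cvg_id|exact: cvg_cst].
Qed.

(** The hyperplanes that avoid 0 and have [q] on them or beyond them, expressed through hitting
    compact sets so that measurability is immediate. *)
Definition separates q : set hyp := hits (segment0 q) `\` hits [set 0].

Lemma separatesP u q H : plane H = [set x | dot u x = 1] ->
  separates q H <-> 1 <= dot u q.
Proof.
move=> Hu; split=> [[[x [Hx [t t01 tx]]] _]|uq1].
  move: t01 Hx; rewrite -tx Hu /= in_itv/= dotZr => /andP[t0 t1] tuq.
  rewrite -tuq ler_piMl//; rewrite leNgt; apply/negP => uq0.
  by have := mulr_ge0_le0 t0 (ltW uq0); rewrite tuq ler10.
have uq0 : 0 < dot u q := lt_le_trans ltr01 uq1.
split; last first.
  by move=> /hits1; rewrite Hu /= dot0r => /eqP; rewrite eq_sym oner_eq0.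
exists ((dot u q)^-1 *: q); split.
  by rewrite Hu /= dotZr mulVf// gt_eqF.
exists (dot u q)^-1 => //=; rewrite in_itv/= invr_ge0 (ltW uq0)/=.
by rewrite invf_le1.
Qed.

Lemma separates_norm q H : separates q H ->
  exists2 u, plane H = [set x | dot u x = 1] & 1 <= dot u q.
Proof.
move=> sqH; have [_ H0] := sqH.
have [u Hu] := plane_norm (fun h => H0 ((hits1 _ _).2 h)).
by exists u => //; apply/(separatesP _ Hu).
Qed.

Lemma measurable_separates q : measurable (separates q).
Proof.
apply: measurableD; apply: measurable_hits; first exact: segment0_compact.
exact: compact_set1.
Qed.

(* Rational dilations make [0 < u . p /\ u . q < u . p] a countable combination
   of hitting conditions. *)
Definition meets_first p q : set hyp :=
  \bigcup_(k : rat) (separates (`|ratr k| *: p) `\` separates (`|ratr k| *: q)).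

Lemma meets_firstP u p q H : plane H = [set x | dot u x = 1] ->
  meets_first p q H <-> 0 < dot u p /\ dot u q < dot u p.
Proof.
move=> Hu; split=> [[k _ []]|[up0 uqp]].
  set r := `|_|; have r0 : 0 <= r by exact: normr_ge0.
  move/(separatesP _ Hu); rewrite dotZr => rp.
  move/(separatesP _ Hu)/negP; rewrite -ltNge dotZr => rq.
  have rp0 : 0 < r.
    rewrite lt_neqAle r0 andbT eq_sym; apply/eqP => re0.
    by move: rp; rewrite re0 mul0r ler10.
  split; first by rewrite -(pmulr_rgt0 _ rp0) (lt_le_trans _ rp).
  by rewrite -(ltr_pM2l rp0) (lt_le_trans rq).
(* The rational is taken between the inverses of [dot u p] and [dot u q]. For [dot u q <= 0] there
   is no upper constraint, and [(dot u p)^-1 + 1] serves as an arbitrary bound. *)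
have [r [pr rq]] : exists r : rat, 1 < ratr r * dot u p /\ ratr r * dot u q < 1.
  have [uq0|uq0] := leP (dot u q) 0.
    have /rat_in_itvoo[r] : (dot u p)^-1 < (dot u p)^-1 + 1 by rewrite ltrDl.
    rewrite in_itv/= => /andP[pr _]; exists r; split.
      by rewrite -ltr_pdivrMr// mul1r.
    have r0 : 0 <= ratr r :> R.
      by rewrite ltW// (le_lt_trans _ pr)// invr_ge0 ltW.
    by rewrite (le_lt_trans _ ltr01)// mulr_ge0_le0.
  have /rat_in_itvoo[r] : (dot u p)^-1 < (dot u q)^-1 by rewrite ltf_pV2.
  rewrite in_itv/= => /andP[pr rq]; exists r; split.
    by rewrite -ltr_pdivrMr// mul1r.
  by rewrite -ltr_pdivlMr// mul1r.
have r0 : 0 < ratr r :> R.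
  by rewrite -(pmulr_lgt0 _ up0) (lt_trans ltr01).
exists r => //; rewrite gtr0_norm//; split.
  by apply/(separatesP _ Hu); rewrite dotZr ltW.
by move/(separatesP _ Hu); rewrite dotZr leNgt rq.
Qed.

Lemma measurable_meets_first p q : measurable (meets_first p q).
Proof.
apply: bigcupT_measurable_rat => k.
by apply: measurableD; exact: measurable_separates.
Qed.

End hyperplanes.

(** * Sorting hyperplanes by their supporting vertex *)

Section face_decomposition.
Context (R : realType) (l : nat).
Local Notation V := 'rV[R]_l.+1.
Local Notation hyperplane := (hyperplane R l).
Local Notation hyp := (borelType (Defs.hyperplane R l)).
Context (s : seq V).
Local Notation p := (nth (0 : V) s).
Implicit Types (u v : V) (H : hyperplane) (b c : R) (j : nat).

(** The second factor says that no vertex beats [p j], the third that [p j] strictly beats all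
    earlier ones: ties go to the least index, which makes the classes disjoint. *)
Definition face_hits j c : set hyp :=
  separates (c *: p j)
  `&` \bigcap_(i in [set i | (i < size s)%N]) ~` meets_first (p i) (p j)
  `&` \bigcap_(i in [set i | (i < j)%N]) meets_first (p j) (p i).

Lemma face_hitsP u H j c : plane H = [set x | dot u x = 1] -> 0 < c ->
  face_hits j c H <-> [/\ 1 <= c * dot u (p j),
    forall i, (i < size s)%N -> dot u (p i) <= dot u (p j) &
    forall i, (i < j)%N -> dot u (p i) < dot u (p j)].
Proof.
move=> Hu c0; split=> [[[/(separatesP _ Hu)]]|[h1 h2 h3]].
  rewrite dotZr => h1 h2 h3; split=> // i ij; last first.
    by have [] := (meets_firstP _ _ Hu).1 (h3 i ij).
  rewrite leNgt; apply/negP => lt; apply: (h2 i ij).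
  apply/(meets_firstP _ _ Hu).
  split=> //; apply: lt_trans lt.
  by rewrite -(pmulr_rgt0 _ c0) (lt_le_trans ltr01).
split; first split; first by apply/(separatesP _ Hu); rewrite dotZr.
  by move=> i ij /(meets_firstP _ _ Hu)[_]; rewrite ltNge h2.
move=> i ij; apply/(meets_firstP _ _ Hu); split; last exact: h3.
by rewrite -(pmulr_rgt0 _ c0) (lt_le_trans ltr01).
Qed.

Lemma face_hits_norm j c H : face_hits j c H ->
  exists u, plane H = [set x | dot u x = 1].
Proof. by move=> [[/separates_norm[u Hu _] _] _]; exists u. Qed.

Lemma measurable_face_hits j c : measurable (face_hits j c).
Proof.
apply: measurableI; first apply: measurableI.
- exact: measurable_separates.
- apply: fin_bigcap_measurable; first exact: finite_II.
  by move=> i _; apply: measurableC; exact: measurable_meets_first.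
- apply: fin_bigcap_measurable; first exact: finite_II.
  by move=> i _; exact: measurable_meets_first.
Qed.

Lemma face_hits_disjoint b c : 0 < b -> 0 < c -> forall i j,
  (i < size s)%N -> (j < size s)%N -> (i < j)%N ->
  face_hits i b `&` face_hits j c = set0.
Proof.
move=> b0 c0 i j si sj ij; rewrite -subset0 => H [Hi Hj].
have [u Hu] := face_hits_norm Hi.
have [_ /(_ _ sj) h _] := (face_hitsP _ Hu b0).1 Hi.
have [_ _ /(_ _ ij)] := (face_hitsP _ Hu c0).1 Hj.
by rewrite ltNge h.
Qed.

Lemma face_hits_sub j b c : 0 < b -> b <= c -> face_hits j b `<=` face_hits j c.
Proof.
move=> b0 bc H Hb; have [u Hu] := face_hits_norm Hb.
have [h1 h2 h3] := (face_hitsP _ Hu b0).1 Hb.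
apply/(face_hitsP _ Hu (lt_le_trans b0 bc)); split=> //.
apply: le_trans (h1) _; apply: ler_wpM2r => //.
by rewrite ltW// -(pmulr_rgt0 _ b0) (lt_le_trans ltr01).
Qed.

(* Translating by [b p_j] pushes the hyperplanes whose supporting vertex is
   [p_j] outwards, from distance at most [c] to distances between [b] and
   [b + c] along the ray through [p_j]. *)
Lemma face_hits_translate j b c : 0 < b -> 0 < c ->
  face_hits j (b + c) `\` face_hits j b =
  translate_planes (b *: p j) (face_hits j c).
Proof.
move=> b0 c0; have bc0 := addr_gt0 b0 c0; apply/seteqP; split=> H.
  move=> [Hbc Hb]; have [u Hu] := face_hits_norm Hbc.
  have [h1 h2 h3] := (face_hitsP _ Hu bc0).1 Hbc.
  set m := dot u (p j) in h1 h2 h3.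
  (* The maximality conditions do not involve [b], so lying outside [face_hits j b] can only mean
     [b * m < 1]. Translation back by [b *: p j] then turns the level 1 into [1 - b * m], which is
     rescaled to 1. *)
  have bm : 0 < 1 - b * m.
    rewrite subr_gt0 ltNge; apply/negP => bm; apply: Hb.
    by apply/(face_hitsP _ Hu b0).
  have [H0 eH0] := shift_plane_exists H (- (b *: p j)).
  apply/(translate_planesP _ eH0).
  have H0u : plane H0 = [set x | dot ((1 - b * m)^-1 *: u) x = 1].
    rewrite eH0 (shift_planeE _ Hu) -dot_eq_norm ?gt_eqF//.
    by rewrite -scaleNr dotZr mulNr.
  have im : 0 < (1 - b * m)^-1 by rewrite invr_gt0.
  apply/(face_hitsP _ H0u c0); rewrite !dotZl -/m; split.
  - by rewrite mulrCA mulrC ler_pdivlMr// mul1r lerBlDr addrC -mulrDl.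
  - by move=> i si; rewrite !dotZl ler_pM2l// h2.
  - by move=> i ij; rewrite !dotZl ltr_pM2l// h3.
have [H0 eH0] := shift_plane_exists H (- (b *: p j)).
move=> /(translate_planesP _ eH0) HS.
have [u H0u] := face_hits_norm HS.
have [h1 h2 h3] := (face_hitsP _ H0u c0).1 HS.
set m := dot u (p j) in h1 h2 h3.
have m0 : 0 < m by rewrite -(pmulr_rgt0 _ c0) (lt_le_trans ltr01).
(* Conversely the outward translation raises the level from 1 to [1 + b * m], again rescaled to
   1. *)
have bm : 0 < 1 + b * m by rewrite addr_gt0// mulr_gt0.
have Hu : plane H = [set x | dot ((1 + b * m)^-1 *: u) x = 1].
  rewrite -dot_eq_norm ?gt_eqF// -dotZr -(shift_planeE _ H0u).
  by rewrite eH0 shift_planeK.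
have im : 0 < (1 + b * m)^-1 by rewrite invr_gt0.
split; last first.
  move=> /(face_hitsP _ Hu b0)[]; rewrite dotZl -/m mulrCA mulrC.
  by rewrite ler_pdivlMr// mul1r gerDr leNgt ltr01.
apply/(face_hitsP _ Hu bc0); rewrite !dotZl -/m; split.
- by rewrite mulrCA mulrC ler_pdivlMr// mul1r mulrDl addrC lerD2l.
- by move=> i si; rewrite !dotZl ler_pM2l// h2.
- by move=> i ij; rewrite !dotZl ltr_pM2l// h3.
Qed.

Lemma hits_dilate_faces c : 0 < c -> convex_hull [set` s] 0 ->
  hits (dilate c (convex_hull [set` s])) =
  hits [set 0] `|` \bigcup_(j < size s) face_hits j c.
Proof.
move=> c0 W0; apply/seteqP; split=> H; last first.
  move=> [/hits1 H0|[j /= js Hj]].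
    by exists 0; split=> //; exists 0; rewrite ?scaler0.
  have [u Hu] := face_hits_norm Hj.
  have [h1 _ _] := (face_hitsP _ Hu c0).1 Hj.
  have m0 : 0 < dot u (p j) by rewrite -(pmulr_rgt0 _ c0) (lt_le_trans ltr01).
  (* The point where the hyperplane crosses the ray through [p j]; it lies in the dilate because
     [1 <= c * dot u (p j)]. *)
  exists ((dot u (p j))^-1 *: p j); split.
    by rewrite Hu /= dotZr mulVf// gt_eqF.
  exists ((c * dot u (p j))^-1 *: p j + (1 - (c * dot u (p j))^-1) *: 0).
    have /convex_setP := @convex_hull_convex R l [set` s]; apply=> //.
    - by apply: sub_convex_hull => /=; exact: mem_nth.
    - by rewrite invr_ge0 (le_trans ler01).
    - by rewrite invf_le1// (lt_le_trans ltr01).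
  by rewrite scaler0 addr0 scalerA invfM mulrA mulfV ?gt_eqF// mul1r.
have [H0|H0 [x [Hx Wx]]] := pselect (plane H 0); first by left; apply/hits1.
right; have [u Hu] := plane_norm H0.
(* If no vertex reached the hyperplane, the whole dilated hull would lie in the open half-space on
   the side of 0. *)
have [j0 j0s uj0] : exists2 j, (j < size s)%N & 1 <= c * dot u (p j).
  apply: contrapT => no.
  have sub : convex_hull [set` s] `<=` [set y | c * dot u y < 1].
    apply: convex_hull_sub.
      apply/convex_setP => y z t /= uy uz t0 t1.
      rewrite dotDr !dotZr.
      have [->|nt1] := eqVneq t 1; first by rewrite subrr mul0r addr0 mul1r.
      have : t < 1 by rewrite lt_neqAle nt1.
      by nra.
    move=> y /= /(nthP 0)[j js <-]; rewrite ltNge; apply/negP => uj.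
    by apply: no; exists j.
  move: Wx Hx => [y /sub/= + <-]; rewrite Hu /= dotZr => /[swap] ->.
  by rewrite ltxx.
pose argm j := (j < size s)%N &&
  [forall i : 'I_(size s), dot u (p i) <= dot u (p j)].
have exj : exists j, argm j.
  exists [arg max_(i > Ordinal j0s) dot u (p i)]%O.
  case: arg_maxP => // i _ imax; rewrite /argm ltn_ord/=.
  by apply/forallP => k; exact: imax.
case: (ex_minnP exj) => j /andP[js /forallP jmax] jmin.
exists j => //; apply/(face_hitsP _ Hu c0); split.
- apply: le_trans uj0 _; apply: ler_wpM2l; first exact: ltW.
  exact: (jmax (Ordinal j0s)).
- by move=> i si; exact: (jmax (Ordinal si)).
- move=> i ij; rewrite ltNge; apply/negP => ji.
  have : argm i.
    rewrite /argm (ltn_trans ij)//=; apply/forallP => k.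
    exact: le_trans (jmax k) ji.
  by move=> /jmin; rewrite leqNgt ij.
Qed.

End face_decomposition.

(** * Null pencils through the origin and linearity under dilation *)

Section homogeneity.
Context (R : realType) (l : nat).
Local Notation V := 'rV[R]_l.+1.
Local Notation hyperplane := (hyperplane R l).
Local Notation hyp := (borelType (Defs.hyperplane R l)).
Context (Lambda : {measure set hyp -> \bar R}).
Implicit Types (u v x y : V) (H : hyperplane) (b c : R) (W : set V).

Lemma translate_hits1D v x y :
  translate_planes v (hits [set x] `\` hits [set y]) =
  hits [set x + v] `\` hits [set y + v].
Proof.
apply/seteqP; split=> H; have [H0 eH0] := shift_plane_exists H (- v);
  have eP z : plane H0 z <-> plane H (z + v).
- rewrite eH0; split=> [[w Hw <-]|Hz]; first by rewrite subrK.
  by exists (z + v); rewrite ?addrK.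
- move=> /(translate_planesP _ eH0)[/hits1/eP Hx Hy]; split; first exact/hits1.
  by move=> /hits1/eP h; apply/Hy/hits1.
- rewrite eH0; split=> [[w Hw <-]|Hz]; first by rewrite subrK.
  by exists (z + v); rewrite ?addrK.
- move=> [/hits1/eP Hx Hy]; apply/(translate_planesP _ eH0).
  by split; [exact/hits1|move=> /hits1/eP h; apply/Hy/hits1].
Qed.

Lemma dot_delta u (i : 'I_l.+1) : dot u (delta_mx ord0 i) = u ord0 i.
Proof.
rewrite /dot (bigD1 i)//= big1 ?mxE ?eqxx ?mulr1 ?addr0// => j ji.
by rewrite mxE (negbTE ji) andbF mulr0.
Qed.

Lemma measurable_hits1D x y :
  measurable (hits [set x] `\` hits [set y] : set hyp).
Proof. by apply: measurableD; apply: measurable_hits; exact: compact_set1. Qed.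

(* The translates of this family along [e_i] are pairwise disjoint and of equal
   measure, and infinitely many of them consist of hyperplanes hitting [W]. *)
Lemma pencil_null W (i : 'I_l.+1) : translation_invariant Lambda ->
  compact W -> (Lambda (hits W) < +oo)%E -> W° 0 ->
  Lambda (hits [set 0] `\` hits [set delta_mx ord0 i]) = 0%E.
Proof.
move=> tL cW fW W0; set e : V := delta_mx ord0 i.
have [eps eps0 Weps] : exists2 eps : R, 0 < eps &
    forall s, 0 < s -> s <= eps -> W (s *: e).
  have : \forall s \near (0 : R)^'+, W (s *: e).
    suff /(_ W) : s *: e @[s --> (0 : R)^'+] --> (0 : V) by exact.
    apply: cvg_at_right_filter; rewrite -[X in _ --> X](scale0r e).
    by apply: cvgZ; [exact: cvg_id|exact: cvg_cst].
  move=> [d /= d0 dW]; exists (d / 2); first by rewrite divr_gt0.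
  move=> s s0 sd; apply: dW => //=.
  rewrite sub0r normrN gtr0_norm// (le_lt_trans sd)//.
  by rewrite ltr_pdivrMr// ltr_pMr// ltr1n.
(* Distinct offsets not exceeding [eps], so that every [a k *: e] lies in [W]. *)
pose a (k : nat) : R := eps / k.+1%:R.
have a0 k : 0 < a k by rewrite divr_gt0.
have aeps k : a k <= eps by rewrite ler_pdivrMr// ler_peMr ?ler1n// ltW.
have ainj k k' : a k = a k' -> k = k'.
  rewrite /a => /(mulfI (lt0r_neq0 eps0))/invr_inj/eqP.
  by rewrite eqr_nat eqSS => /eqP.
pose F k : set hyp := hits [set 0 + a k *: e] `\` hits [set e + a k *: e].
have FE k : Lambda (F k) = Lambda (hits [set 0] `\` hits [set e]).
  rewrite /F -translate_hits1D; apply: tL; exact: measurable_hits1D.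
have mF k : measurable (F k) by exact: measurable_hits1D.
have tF : trivIset setT F.
  move=> k k' _ _ [H [[/hits1 h1 h2] [/hits1 h1' h2']]].
  have [u [r [u0 Hu]]] := planeP H; move: h1 h1' h2.
  rewrite !add0r Hu /= !dotZr => h1 h1' h2.
  (* A hyperplane through two different points [a k *: e] is parallel to [e], so it also contains
     [e + a k *: e], which [F k] excludes. *)
  apply: ainj; apply/eqP; rewrite -subr_eq0; apply: contraT => nk.
  have : (a k - a k') * dot u e = 0 by rewrite mulrBl h1 h1' subrr.
  move/eqP; rewrite mulf_eq0 (negbTE nk)/= => /eqP ue.
  exfalso; apply: h2; apply/hits1; rewrite Hu /= dotDr dotZr h1 ue add0r.
  by [].
have FW k : F k `<=` hits W.
  move=> H [/hits1 h _]; exists (a k *: e).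
  split; first by rewrite -[_ *: _]add0r.
  exact: Weps.
set m := Lambda _.
have m0 : (0 <= m)%E by exact: measure_ge0.
have mN n : (m *+ n <= Lambda (hits W))%E.
  have -> : (m *+ n = Lambda (\big[setU/set0]_(k < n) F k))%E.
    rewrite (@measure_bigsetU _ _ _ Lambda F mF tF n).
    rewrite (eq_bigr (fun=> m)) ?big_const_ord ?iter_addr_0// => k _.
    exact: FE.
  apply: le_measure; rewrite ?inE; [|exact: measurable_hits|].
    exact: bigsetU_measurable.
  by rewrite -bigcup_mkord => H [k _ /FW].
have mfin : m \is a fin_num by rewrite ge0_fin_numE// (le_lt_trans (mN 1%N)).
have Wfin : Lambda (hits W) \is a fin_num by rewrite ge0_fin_numE ?measure_ge0.
move: mN m0; rewrite -(fineK mfin) -(fineK Wfin).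
set r := fine m; set M := fine _.
move=> mN; rewrite lee_fin => r0; congr EFin; apply/eqP; rewrite eq_le r0 andbT.
rewrite leNgt; apply/negP => rp.
have M0 : 0 <= M / r.
  by rewrite divr_ge0// -lee_fin (le_trans _ (mN 0%N)).
have := mN (Num.truncn (M / r)).+1.
rewrite -EFin_natmul lee_fin leNgt -mulr_natl -ltr_pdivrMr//.
by have /andP[_ ->] := truncn_itv M0.
Qed.

(** The normal of a hyperplane through 0 has a nonzero coordinate [i], so the hyperplane misses the
    basis vector [e_i] and belongs to one of the null pencils. *)
Lemma through0_null W : translation_invariant Lambda ->
  compact W -> (Lambda (hits W) < +oo)%E -> W° 0 ->
  Lambda (hits [set 0]) = 0%E.
Proof.
move=> tL cW fW W0.
have m0 : measurable (hits [set 0] : set hyp).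
  by apply: measurable_hits; exact: compact_set1.
apply/(negligibleP Lambda m0).
pose B k : set hyp := hits [set 0] `\` hits [set (delta_mx ord0 (inord k) : V)].
apply: (@negligibleS _ _ _ Lambda (\bigcup_k B k)).
  move=> H H0; have [u [r [u0 Hu]]] := planeP H.
  have [i ui] : exists i, u ord0 i != 0.
    apply: contrapT => /forallNP ui; move/eqP: u0; apply; apply/rowP => i.
    by rewrite mxE; apply/eqP; apply: contrapT => /negP; exact: ui.
  exists (i : nat) => //; rewrite /B inord_val; split=> // /hits1.
  move: H0 => /hits1; rewrite Hu /= dot0r dot_delta => <- ui0.
  by move: ui; rewrite ui0 eqxx.
apply: negligible_bigcup => k; apply/negligibleP.
  exact: measurable_hits1D.
exact: pencil_null cW fW W0.
Qed.

Lemma hits_dilate_measure W c : driving_measure Lambda -> polytope W ->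
  W° 0 -> 0 < c ->
  fine (Lambda (hits (dilate c W))) = c * fine (Lambda (hits W)).
Proof.
move=> dL pW W0 c0; have [_ _ tL _ finL] := dL.
have [[S /finite_seqP[s ->] WE] _] := pW.
have WW0 : convex_hull [set` s] 0 by rewrite -WE; exact: interior_subset.
have cn0 b : 0 < b -> b != 0 by move=> b0; rewrite gt_eqF.
pose f b := fine (Lambda (hits (dilate b W))).
have Wfin b : 0 < b -> (Lambda (hits (dilate b W)) < +oo)%E.
  by move=> b0; apply: finL; apply: dilate_polytope => //; exact: cn0.
have mhits b : 0 < b -> measurable (hits (dilate b W) : set hyp).
  move=> b0; apply: measurable_hits; apply: polytope_compact.
  by apply: dilate_polytope => //; exact: cn0.
have face_sub j b : 0 < b -> (j < size s)%N ->
    face_hits s j b `<=` hits (dilate b W).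
  move=> b0 js; rewrite WE hits_dilate_faces// => H Hj; right.
  by exists j.
have face_fin j b : 0 < b -> (j < size s)%N ->
    Lambda (face_hits s j b) \is a fin_num.
  move=> b0 js; rewrite ge0_fin_numE ?measure_ge0//.
  apply: le_lt_trans (Wfin b b0); apply: le_measure; rewrite ?inE.
  - exact: measurable_face_hits.
  - exact: mhits.
  - exact: face_sub.
(* The hyperplanes through 0 are null and the face classes are disjoint, so additivity in [b] can be
   checked on each face. *)
have fE b : 0 < b -> f b = \sum_(j < size s) fine (Lambda (face_hits s j b)).
  move=> b0; rewrite /f WE hits_dilate_faces// setUC measureU0; last 3 first.
  - by apply: bigcup_measurable => j _; exact: measurable_face_hits.
  - by apply: measurable_hits; exact: compact_set1.
  - by apply: through0_null (polytope_compact pW) (finL _ pW) W0.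
  rewrite sum_fine; last by move=> j _; exact: face_fin.
  rewrite bigcup_mkord (@measure_bigsetU_ord _ _ _ Lambda _ xpredT
    (fun j => face_hits s j b))//.
    by move=> j; exact: measurable_face_hits.
  move=> i j _ _ [H [Hi Hj]]; apply/val_inj/eqP; rewrite eqn_leq.
  have disj (k k' : 'I_(size s)) :
      face_hits s k b H -> face_hits s k' b H -> (k <= k')%N.
    move=> Hk Hk'; rewrite leqNgt; apply/negP => kk'.
    have disj := face_hits_disjoint b0 b0 (ltn_ord k') (ltn_ord k) kk'.
    by have : set0 H by rewrite -disj.
  by rewrite !disj.
rewrite -[X in _ = _ * fine (Lambda (hits X))]dilate1.
apply: (@additive_linear R f) => // [b b' b0 b'0|b b0]; last first.
  by rewrite fine_ge0 ?measure_ge0.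
rewrite !fE ?addr_gt0// -big_split/=; apply: eq_bigr => j _.
rewrite -fineD ?face_fin//; congr fine.
have bb' : b <= b + b' by rewrite lerDl ltW.
(* The class for [b + b'] is the class for [b] together with a translate of the class for [b'],
   which has the same measure. *)
rewrite -(setDUK (@face_hits_sub _ _ s j _ _ b0 bb')).
rewrite measureU; last 3 first.
- exact: measurable_face_hits.
- by apply: measurableD; exact: measurable_face_hits.
- exact: setDIK.
congr (_ + _)%E.
have := tL (b *: nth 0 s j) _ (measurable_face_hits s j b').
by rewrite -face_hits_translate.
Qed.

End homogeneity.

(** * Runs in an independent sequence *)

Section cylinders.
Context d (Omega : measurableType d) (R : realType) (P : probability Omega R).
Context d' (T : measurableType d').
Implicit Types (X : nat -> Omega -> T) (B C : nat -> set T) (A : set Omega).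

Definition pr A : R := fine (P A).

Lemma prE A : measurable A -> P A = (pr A)%:E.
Proof. by move=> mA; rewrite fineK// fin_num_measure. Qed.

Lemma pr_setT : pr setT = 1.
Proof. by rewrite /pr probability_setT. Qed.

Lemma pr_ge0 A : 0 <= pr A.
Proof. by rewrite fine_ge0// measure_ge0. Qed.

Lemma pr_le A A' : measurable A -> measurable A' -> A `<=` A' -> pr A <= pr A'.
Proof.
by move=> mA mA' AA'; rewrite -lee_fin -!prE//; apply: le_measure; rewrite ?inE.
Qed.

Lemma prD A A' : measurable A -> measurable A' ->
  pr (A `\` A') = pr A - pr (A `&` A').
Proof.
move=> mA mA'; apply: EFin_inj; rewrite EFinB -(prE mA).
rewrite -(prE (measurableD mA mA')) -(prE (measurableI _ _ mA mA')).
apply: measureD => //.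
by rewrite -ge0_fin_numE ?measure_ge0// fin_num_measure.
Qed.

Definition independent_seq X := forall (s : seq nat) B, uniq s ->
  (forall n, measurable (B n)) ->
  P (\big[setI/setT]_(n <- s) (X n @^-1` B n)) =
  (\prod_(n <- s) P (X n @^-1` B n))%E.

Lemma independent_seq_shift X m :
  independent_seq X -> independent_seq (fun n => X (m + n)%N).
Proof.
move=> iX s B us mB.
have := iX (map (addn m) s) (fun n => B (n - m)%N).
rewrite !big_map map_inj_uniq; last exact: addnI.
move=> /(_ us (fun=> mB _)).
under eq_bigr do rewrite addKn.
by under [X in _ = X -> _]eq_bigr do rewrite addKn.
Qed.

Definition cyl X B : set Omega := [set w | forall n, B n (X n w)].

Section independent.
Variable X : nat -> Omega -> T.
Hypothesis mX : forall n, measurable_fun setT (X n).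
Hypothesis iX : independent_seq X.

Lemma measurable_event n (b : set T) : measurable b -> measurable (X n @^-1` b).
Proof. by move=> mb; rewrite -[_ @^-1` _]setTI; exact: mX. Qed.

Lemma cylE B : cyl X B = \bigcap_n (X n @^-1` B n).
Proof.
by apply/seteqP; split=> w h; [move=> n _; exact: h|move=> n; exact: (h n I)].
Qed.

Lemma cylI B C : cyl X B `&` cyl X C = cyl X (fun n => B n `&` C n).
Proof.
apply/seteqP; split=> w; first by move=> [h h'] n.
by move=> h; split=> n; case: (h n).
Qed.

Lemma measurable_cyl B : (forall n, measurable (B n)) -> measurable (cyl X B).
Proof.
move=> mB; rewrite cylE; apply: bigcapT_measurable => n.
exact: measurable_event.
Qed.

Lemma pr_bigcap N B : (forall n, measurable (B n)) ->
  pr (\bigcap_(n < N) (X n @^-1` B n)) = \prod_(n < N) pr (X n @^-1` B n).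
Proof.
move=> mB; rewrite bigcap_mkord; apply: EFin_inj.
rewrite -prE; last by apply: bigsetI_measurable => i _; exact: measurable_event.
have us : uniq (index_iota 0 N) by exact: iota_uniq.
have := iX us mB; rewrite !big_mkord => ->.
rewrite -prodEFin; apply: eq_bigr => i _; rewrite prE//.
exact: measurable_event.
Qed.

(** An infinite cylinder is the decreasing intersection of the finite ones, whose probabilities are
    products by independence. *)
Lemma cvg_pr_cyl B : (forall n, measurable (B n)) ->
  (fun N => \prod_(n < N) pr (X n @^-1` B n)) @ \oo --> pr (cyl X B).
Proof.
move=> mB; pose F N := \bigcap_(n < N) (X n @^-1` B n).
have mF N : measurable (F N).
  apply: fin_bigcap_measurable; first exact: finite_II.
  by move=> n _; exact: measurable_event.
have FE : cyl X B = \bigcap_N F N.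
  apply/seteqP; split=> w h; first by move=> N _ n _; exact: h.
  by move=> n; apply: (h n.+1 I); exact: ltnSn.
have -> : (fun N => \prod_(n < N) pr (X n @^-1` B n)) = fine \o (P \o F).
  by apply/funext => N /=; rewrite -pr_bigcap.
rewrite /pr FE; apply: fine_cvg; rewrite fineK; last first.
  by apply: fin_num_measure; exact: bigcapT_measurable.
apply: nonincreasing_cvg_mu => //.
- by rewrite -ge0_fin_numE ?measure_ge0// fin_num_measure.
- exact: bigcapT_measurable.
- move=> m n mn; apply/subsetPset => w h k /= km; apply: h.
  exact: leq_trans km mn.
Qed.

Lemma pr_cyl_eq B (q : R) : (forall n, measurable (B n)) ->
  (fun N => \prod_(n < N) pr (X n @^-1` B n)) @ \oo --> q -> pr (cyl X B) = q.
Proof.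
move=> mB Bq; apply: (cvg_unique _ (cvg_pr_cyl mB) Bq); exact: Rhausdorff.
Qed.

(** At every index at least one of the two constraints is trivial, so the finite products factor,
    and the factorization passes to the limit. *)
Lemma pr_cylI B C :
  (forall n, measurable (B n)) -> (forall n, measurable (C n)) ->
  (forall n, B n = setT \/ C n = setT) ->
  pr (cyl X B `&` cyl X C) = pr (cyl X B) * pr (cyl X C).
Proof.
move=> mB mC BC.
rewrite cylI; apply: pr_cyl_eq; first by move=> n; exact: measurableI.
rewrite (_ : (fun N => _) = (fun N => \prod_(n < N) pr (X n @^-1` B n) *
    \prod_(n < N) pr (X n @^-1` C n))).
  by apply: cvgM; exact: cvg_pr_cyl.
apply/funext => N; rewrite -big_split/=; apply: eq_bigr => n _.
case: (BC n) => ->; rewrite ?setTI ?setIT preimage_setT pr_setT.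
  by rewrite mul1r.
by rewrite mulr1.
Qed.

End independent.

(** * Almost sure recurrence of runs *)

Section recurrence.
Variable X : nat -> Omega -> T.
Hypothesis mX : forall n, measurable_fun setT (X n).
Hypothesis iX : independent_seq X.
Variables (b : nat -> set T) (beta : nat -> R) (q : R).
Hypothesis mb : forall j, measurable (b j).
Hypothesis prb : forall n j, pr (X n @^-1` b j) = beta j.
Hypothesis beta_q : (fun N => \prod_(j < N) beta j) @ \oo --> q.
Hypothesis q0 : 0 < q.

Let mX_shift m n : measurable_fun setT (X (m + n)%N) := mX (m + n)%N.

Definition run m : set Omega := [set w | forall j, b j (X (m + j)%N w)].

Lemma runE m : run m = cyl (fun n => X (m + n)%N) b.
Proof. by []. Qed.

Lemma measurable_run m : measurable (run m).
Proof. exact: (measurable_cyl (mX_shift m) mb). Qed.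

Lemma pr_run m : pr (run m) = q.
Proof.
rewrite runE.
apply: (pr_cyl_eq (mX_shift m) (independent_seq_shift m iX) mb).
by under eq_fun do under eq_bigr do rewrite prb.
Qed.

(** The value [setT] outside [[m, m + L)] turns a finite block into a cylinder over all indices, so
    that [pr_cylI] applies to it. *)
Definition block_event m L n : set T :=
  if (m <= n < m + L)%N then b (n - m)%N else setT.

Lemma measurable_block_event m L n : measurable (block_event m L n).
Proof. by rewrite /block_event; case: ifP. Qed.

Lemma cyl_block m L : cyl X (block_event m L) =
  \bigcap_(j < L) (X (m + j)%N @^-1` b j).
Proof.
apply/seteqP; split=> w h.
  move=> j /= jL; have := h (m + j)%N.
  by rewrite /block_event leq_addr ltn_add2l jL addKn.
move=> n; rewrite /block_event; case: ifPn => // /andP[mn nmL].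
have := h (n - m)%N; rewrite /= subnKC//; apply.
by rewrite ltn_subLR.
Qed.

Let g L : R := \prod_(j < L) beta j.

Lemma pr_block m L : pr (cyl X (block_event m L)) = g L.
Proof.
rewrite cyl_block.
rewrite (pr_bigcap (mX_shift m) (independent_seq_shift m iX) L mb).
by under eq_bigr do rewrite prb.
Qed.

Lemma run_sub_block m L : run m `<=` cyl X (block_event m L).
Proof. by move=> w h; rewrite cyl_block => j _; exact: h. Qed.

Definition no_block M L i : set Omega :=
  \bigcap_(k < i) ~` cyl X (block_event (M + k * L)%N L).

Lemma measurable_no_block M L i : measurable (no_block M L i).
Proof.
apply: fin_bigcap_measurable => [|k _]; first exact: finite_II.
apply: measurableC; apply: measurable_cyl => //.
by move=> n; exact: measurable_block_event.
Qed.

Lemma bigcap_lt_recr (F : nat -> set Omega) i :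
  \bigcap_(k < i.+1) F k = \bigcap_(k < i) F k `&` F i.
Proof. by rewrite !bigcap_mkord big_ord_recr. Qed.

Lemma pr_no_block M L i C : (forall n, measurable (C n)) ->
  (forall n, (n < M + i * L)%N -> C n = setT) ->
  pr (no_block M L i `&` cyl X C) = (1 - g L) ^+ i * pr (cyl X C).
Proof.
elim: i C => [|i IH] C mC CT.
  by rewrite /no_block bigcap_mkord big_ord0 setTI expr0 mul1r.
pose D := block_event (M + i * L) L.
have mD n : measurable (D n) by exact: measurable_block_event.
have mcC : measurable (cyl X C) by exact: measurable_cyl.
have mcD : measurable (cyl X D) by exact: measurable_cyl.
(* Excluding block [i] is a set difference. The induction hypothesis applies both to [C] and to [C]
   intersected with that block, and the two are independent since [C] starts after the block. *)
have -> : no_block M L i.+1 `&` cyl X C =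
    (no_block M L i `&` cyl X C) `\` cyl X D.
  by rewrite /no_block bigcap_lt_recr setDE setIAC.
rewrite prD//; last by apply: measurableI => //; exact: measurable_no_block.
have CT' n : (n < M + i * L)%N -> C n = setT.
  move=> ni; apply: CT; rewrite (leq_trans ni)// leq_add2l leq_mul2r.
  by rewrite leqnSn orbT.
rewrite IH// -setIA cylI IH.
- rewrite -cylI pr_cylI//.
    by rewrite pr_block exprSr; ring.
  move=> n; have [nlt|nge] := ltnP n (M + i.+1 * L); first by left; exact: CT.
  right; rewrite /D /block_event -addnA -mulSnr ltnNge nge andbF//.
- by move=> n; exact: measurableI.
- by move=> n ni; rewrite CT'// /D /block_event leqNgt ni setTI.
Qed.

(* The events "block [k] is the first completed one and extends to a run" are
   disjoint, of probability [(1 - g L) ^+ k * q]. *)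
Lemma no_run_bound M L i :
  q * (1 - (1 - g L) ^+ i) <=
  g L * (1 - pr (\bigcap_(k < i) ~` run (M + k * L)%N)).
Proof.
elim: i => [|i IH].
  rewrite expr0 subrr mulr0 (_ : \bigcap_(k < 0) _ = setT); last first.
    by apply/seteqP; split=> // w _ k.
  by rewrite pr_setT subrr mulr0.
set Q := \bigcap_(k < i) _ in IH.
have mQ : measurable Q.
  apply: fin_bigcap_measurable => [|k _]; first exact: finite_II.
    by apply: measurableC; exact: measurable_run.
rewrite bigcap_lt_recr -/Q -setDE prD//; last exact: measurable_run.
set m := (M + i * L)%N.
have : pr (no_block M L i `&` run m) <= pr (Q `&` run m).
  apply: pr_le.
  - by apply: measurableI; [exact: measurable_no_block|exact: measurable_run].
  - by apply: measurableI => //; exact: measurable_run.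
  - move=> w [Nw Aw]; split=> // k ki rw; apply: (Nw k ki).
    exact: run_sub_block rw.
(* The run from [m] as a cylinder unconstrained before [m], hence independent of the blocks that end
   there. *)
pose C n := if (m <= n)%N then b (n - m)%N else setT.
have mC n : measurable (C n) by rewrite /C; case: ifP.
have runC : run m = cyl X C.
  apply/seteqP; split=> w h.
    move=> n; rewrite /C; case: ifPn => // mn.
    by have := h (n - m)%N; rewrite subnKC.
  by move=> j; have := h (m + j)%N; rewrite /C leq_addr addKn.
rewrite {1}runC pr_no_block//; last by move=> n nm; rewrite /C leqNgt nm.
rewrite -runC pr_run => le.
have g0 : 0 <= g L by apply: prodr_ge0 => j _; rewrite -(prb 0); exact: pr_ge0.
(* The new term contributes at least [g L * (1 - g L) ^+ i * q], which is exactly the increment of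
   the left-hand side from [i] to [i + 1]. *)
have := ler_wpM2l g0 le; move: IH; rewrite exprSr; nra.
Qed.

Lemma no_run_null M : pr (\bigcap_(m in [set m | (M <= m)%N]) ~` run m) = 0.
Proof.
set x := pr _; apply/eqP; rewrite eq_le pr_ge0 andbT.
have mN : measurable (\bigcap_(m in [set m | (M <= m)%N]) ~` run m).
  apply: bigcap_measurable; first by exists M => /=.
  by move=> k _; apply: measurableC; exact: measurable_run.
have bound L i : q * (1 - (1 - g L) ^+ i) <= g L * (1 - x).
  apply: le_trans (no_run_bound M L i) _.
  apply: ler_wpM2l.
    by apply: prodr_ge0 => j _; rewrite -(prb 0); exact: pr_ge0.
  apply: lerB => //; apply: pr_le => //.
    apply: fin_bigcap_measurable => [|k _]; first exact: finite_II.
    by apply: measurableC; exact: measurable_run.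
  by move=> w h k _; apply: h => /=; rewrite leq_addr.
have qg L : q <= g L.
  rewrite -(pr_run 0) -(pr_block 0 L); apply: pr_le; last exact: run_sub_block.
    exact: measurable_run.
  by apply: measurable_cyl => // n; exact: measurable_block_event.
have g1 L : g L <= 1.
  rewrite -(pr_block 0 L) -pr_setT; apply: pr_le => //.
  by apply: measurable_cyl => // n; exact: measurable_block_event.
(* First [i] tends to infinity, where [(1 - g L) ^+ i] vanishes as [0 < g L <= 1]; then [L] does,
   where [g L] tends to [q]. The result [q <= q * (1 - x)] forces [x <= 0]. *)
have qgx L : q <= g L * (1 - x).
  have gL0 : 0 < g L := lt_le_trans q0 (qg L).
  have : (fun i => q * (1 - (1 - g L) ^+ i)) @ \oo --> q * (1 - 0).
    apply: cvgM; first exact: cvg_cst.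
    apply: cvgB; first exact: cvg_cst.
    apply: cvg_expr; have := g1 L.
    by rewrite ger0_norm ?subr_ge0// ltrBlDr ltrDl.
  rewrite subr0 mulr1 => /cvgr_to_le; apply.
  by apply: nearW => i; exact: bound.
have : q <= q * (1 - x).
  apply: (@cvgr_to_ge _ \oo _ _ (fun L => g L * (1 - x))).
    by apply: cvgM => //; exact: cvg_cst.
  by apply: nearW => L; exact: qgx.
by rewrite -subr_ge0 mulrBr mulr1 addrAC subrr add0r oppr_ge0 pmulr_rle0.
Qed.

End recurrence.
End cylinders.

(** * Avoidance probabilities of the STIT tessellation *)

Section stit_avoidance.
Context (R : realType) (l : nat).
Local Notation V := 'rV[R]_l.+1.
Context (Lambda : {measure set (borelType (hyperplane R l)) -> \bar R}).
Hypothesis dL : driving_measure Lambda.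
Context (dY : measure_display) (OmegaY : measurableType dY).
Context (PY : probability OmegaY R) (Y : R -> OmegaY -> set (set V)).
Hypothesis hY : stit Lambda PY Y.
Implicit Types (W Q : set V).

Lemma stit_cell_contains_prob Q (t : R) : polytope Q -> 0 < t ->
  PY ((fun w => restrict_tess Q (Y t w)) @^-1` some_cell_contains Q) =
  (expR (- (t * fine (Lambda (hits Q)))))%:E.
Proof.
move=> pQ t0; have [_ _ /(_ Q pQ)[d' [Om [Pr [X [wX fdd]]]]]] := hY.
rewrite -(no_division_prob dL pQ t0 wX).
have mQ : measurable (some_cell_contains Q : set (tessType Q)).
  apply: measurable_some_cell_contains => //; first exact: polytope_closed.
  by have [_ [x /interior_subset Qx]] := pQ; exists x.
have := fdd 1%N (fun=> t) (fun=> some_cell_contains Q) (fun=> t0) (fun=> mQ).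
have bigcap1 (T : Type) (A : set T) : \bigcap_(i in [set: 'I_1]) A = A.
  by apply/seteqP; split=> x; [move=> /(_ ord0 I)|move=> Ax i _].
by rewrite !bigcap1.
Qed.

(** Having a cell that contains [Q] is the same event in every window containing [Q], so it can be
    evaluated in the window [Q] itself. *)
Lemma stit_window_cell_contains_prob W Q (t : R) : polytope Q -> Q `<=` W ->
  0 < t ->
  PY ((fun w => restrict_tess W (Y t w)) @^-1` some_cell_contains Q) =
  (expR (- (t * fine (Lambda (hits Q)))))%:E.
Proof.
move=> pQ QW t0; rewrite -stit_cell_contains_prob//; congr (PY _).
have Q0 : Q° !=set0 by have [] := pQ.
have QQ : Q `<=` Q by [].
have inW := restrict_some_cell_contains _ Q0 QW.
have inQ := restrict_some_cell_contains _ Q0 QQ.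
by apply/seteqP; split=> w /=; [move=> /inW/inQ|move=> /inQ/inW].
Qed.

Context (W : set V).
Hypotheses (pW : polytope W) (W0 : W° 0).
Context (d : measure_display) (Omega : measurableType d).
Context (P : probability Omega R) (Rs : int -> Omega -> set (set V)).
Hypothesis hRs : independent_copies [set k : int | k <= 0] W P Rs PY
  (fun w => restrict_tess W (Y 1 w)).

Lemma dilate_sub_window (c : R) : 0 < c -> c <= 1 -> dilate c W `<=` W.
Proof.
move=> c0 c1; rewrite -[X in _ `<=` X]dilate1; apply: dilate_sub => //.
- exact: polytope_convex.
- exact: interior_subset.
- exact: ltW.
Qed.

Let pdilate (c : R) : 0 < c -> polytope (dilate c W).
Proof. by move=> c0; apply: dilate_polytope; rewrite ?gt_eqF. Qed.

Lemma boundary_avoids_dilate (c : R) (k : int) (w : Omega) : 0 < c -> c <= 1 ->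
  k <= 0 -> tess_boundary (Rs k w) `&` (dilate c W)° = set0 <->
  some_cell_contains (dilate c W) (Rs k w).
Proof.
move=> c0 c1 k0; have [/(_ k k0)[_ /(_ w) wT] _ _] := hRs.
apply: tess_boundary_misses wT _ _ (dilate_sub_window c0 c1).
- exact/polytope_convex/pdilate.
- by apply: dilate_interior0; rewrite ?gt_eqF.
Qed.

Lemma measurable_contains_dilate (c : R) : 0 < c -> c <= 1 ->
  measurable (some_cell_contains (dilate c W) : set (tessType W)).
Proof.
move=> c0 c1; apply: measurable_some_cell_contains.
- exact: polytope_closed.
- by have [_ [x /interior_subset Qx]] := pdilate c0; exists x.
- exact: dilate_sub_window.
Qed.

Lemma copies_contain_prob (c : R) (k : int) : 0 < c -> c <= 1 -> k <= 0 ->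
  P (Rs k @^-1` some_cell_contains (dilate c W)) =
  (expR (- (c * fine (Lambda (hits W)))))%:E.
Proof.
move=> c0 c1 k0; have [_ law _] := hRs.
rewrite (law k _ k0 (measurable_contains_dilate c0 c1)).
rewrite stit_window_cell_contains_prob//.
- by rewrite mul1r hits_dilate_measure.
- exact: pdilate.
- exact: dilate_sub_window.
Qed.

Lemma copies_avoid_prob (c : R) (k : int) : 0 < c -> c <= 1 -> k <= 0 ->
  P [set w | tess_boundary (Rs k w) `&` (dilate c W)° = set0] =
  (expR (- (c * fine (Lambda (hits W)))))%:E.
Proof.
move=> c0 c1 k0; rewrite -(copies_contain_prob c0 c1 k0); congr (P _).
by apply/seteqP; split=> w /= /(boundary_avoids_dilate w c0 c1 k0).
Qed.

Definition backward_copies (n : nat) : Omega -> tessType W := Rs (- n%:Z).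

Lemma measurable_backward_copies n : measurable_fun setT (backward_copies n).
Proof. by have [/(_ (- n%:Z))[|]//] := hRs; rewrite /= oppr_le0. Qed.

Lemma independent_backward_copies : independent_seq P backward_copies.
Proof.
move=> s B us mB; have [_ _ ind] := hRs.
have us' : uniq [seq - n%:Z | n <- s].
  by rewrite map_inj_uniq// => m n /oppr_inj[].
have neg : [set` [seq - n%:Z | n <- s]] `<=` [set k : int | k <= 0].
  by move=> _ /= /mapP[n _ ->]; rewrite oppr_le0.
have := ind _ (fun k => B `|k|%N) us' neg (fun k => mB _).
rewrite !big_map.
(* The family on integers was defined through the absolute value, which here recovers the index [n]
   from [- n]. *)
under eq_bigr do rewrite abszN absz_nat.
by under [X in _ = X -> _]eq_bigr do rewrite abszN absz_nat.
Qed.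

End stit_avoidance.

(** * Nonpositive indices, the geometric product, and extraction of a sequence *)

Lemma int_npos (P : int -> Prop) :
  (forall k : int, k <= 0 -> P k) <-> (forall n : nat, P (- n%:Z)).
Proof.
split=> [h n|h k k0]; first by apply: h; rewrite oppr_le0.
rewrite -[k]opprK -(ger0_norm (_ : 0 <= - k)) ?oppr_ge0// normrN -abszE.
exact: h.
Qed.

(** The exponents form a geometric series of ratio [a^-1], with sum
    [1 / (1 - a^-1) = a / (a - 1)]. *)
Lemma cvg_prod_expR_geometric (R : realType) (a x : R) : 1 < a ->
  (fun N => \prod_(j < N) expR (- (a ^ (- j%:Z) * x))) @ \oo -->
  expR (- (a / (a - 1) * x)).
Proof.
move=> a1; have a0 : 0 < a := lt_trans ltr01 a1.
have -> : (fun N => \prod_(j < N) expR (- (a ^ (- j%:Z) * x))) =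
    expR \o (fun N => - (series (geometric 1 a^-1) N * x)).
  apply/funext => N /=; rewrite -expR_sum; congr expR.
  rewrite sumrN -mulr_suml /series/= big_mkord; congr (- (_ * _)).
  by apply: eq_bigr => j _; rewrite mul1r exprVn -exprnN.
apply: continuous_cvg; first exact: continuous_expR.
apply: cvgN; apply: cvgMl.
have -> : a / (a - 1) = 1 / (1 - a^-1).
  by field; rewrite gt_eqF//= subr_eq0 gt_eqF.
apply: cvg_geometric_series.
by rewrite gtr0_norm ?invr_gt0// invf_lt1.
Qed.

Lemma increasing_choice (A : set nat) (M0 : nat) :
  (forall M : nat, exists2 m, (M <= m)%N & A m) ->
  exists n : nat -> nat, [/\ forall i, (M0 <= n i)%N,
    forall i, (n i < n i.+1)%N & forall i, A (n i)].
Proof.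
move=> h; pose f M := sval (cid2 (h M)).
have fM M : (M <= f M)%N by rewrite /f; case: cid2.
have Af M : A (f M) by rewrite /f; case: cid2.
exists (fun i => iter i (fun m => f m.+1) (f M0)); split.
- elim=> [|i IH] /=; rewrite ?fM// (leq_trans IH)//.
  exact: leq_trans (leqnSn _) (fM _).
- by move=> i /=; exact: fM.
- by case=> [|i] /=; exact: Af.
Qed.
Theorem lemma2p1 (R : realType) (l : nat)
    (Lambda : {measure set (borelType (hyperplane R l)) -> \bar R})
    (hLambda : driving_measure Lambda)
    (dY : measure_display) (OmegaY : measurableType dY)
    (PY : probability OmegaY R) (Y : R -> OmegaY -> set (set 'rV[R]_l.+1))
    (hY : stit Lambda PY Y)
    (W : set 'rV[R]_l.+1) (hW : polytope W) (hW0 : W° 0)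
    (d : measure_display) (Omega : measurableType d) (P : probability Omega R)
    (Rs : int -> Omega -> set (set 'rV[R]_l.+1))
    (hRs : independent_copies [set k : int | k <= 0] W P Rs PY
             (fun w => restrict_tess W (Y 1 w)))
    (a : R) (ha : 1 < a) :
  [/\ forall k : int, k <= 0 ->
        P [set w | tess_boundary (Rs k w) `&` (dilate (a ^ k) W)° = set0] =
        poweR (P [set w | tess_boundary (Rs 0 w) `&` W° = set0]) (a ^ k),
      P [set w | forall k : int, k <= 0 ->
           tess_boundary (Rs k w) `&` (dilate (a ^ k) W)° = set0] =
        poweR (P [set w | tess_boundary (Rs 0 w) `&` W° = set0])
          (a / (a - 1)),
      (0 < poweR (P [set w | tess_boundary (Rs 0%R w) `&` W° = set0])
             (a / (a - 1)))%E &
      {ae P, forall w, exists n : nat -> int,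
        [/\ forall i, 1 <= n i,
            forall i, n i < n i.+1 &
            forall i (k : int), k <= 0 ->
              tess_boundary (Rs (- n i + k) w) `&` (dilate (a ^ k) W)° =
              set0]}].
Proof.
pose lam := fine (Lambda (hits W)).
have a0 : 0 < a := lt_trans ltr01 ha.
have ak0 (k : int) : 0 < a ^ k by exact: exprz_gt0.
have ak1 (k : int) : k <= 0 -> a ^ k <= 1.
  move: k; apply/(int_npos (fun k => a ^ k <= 1)) => n.
  by rewrite -exprnN invf_le1 ?exprn_gt0// exprn_ege1// ltW.
have p0E : P [set w | tess_boundary (Rs 0 w) `&` W° = set0] = (expR (- lam))%:E.
  have := copies_avoid_prob hLambda hY hW hW0 hRs ltr01 (lexx _) (lexx 0).
  by rewrite dilate1 mul1r.
have powE (r : R) : poweR (expR (- lam))%:E r = (expR (- (r * lam)))%:E.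
  by rewrite poweR_EFin -expRM mulNr mulrC.
pose X := backward_copies W Rs.
pose b (j : nat) : set (tessType W) :=
  some_cell_contains (dilate (a ^ (- j%:Z)) W).
have j0 (j : nat) : - j%:Z <= 0 by rewrite oppr_le0.
have mX n : measurable_fun setT (X n) := measurable_backward_copies hRs n.
have iX : independent_seq P X := independent_backward_copies hRs.
have mb j : measurable (b j).
  by apply: measurable_contains_dilate => //; exact: ak1.
have prb n j : pr P (X n @^-1` b j) = expR (- (a ^ (- j%:Z) * lam)).
  rewrite /pr (copies_contain_prob hLambda hY hW hW0 hRs)//.
  exact: ak1.
have bq := @cvg_prod_expR_geometric R a lam ha.
(* A run from [m] in the reversed sequence is the event of the recurrence claim for [n_i = m]; the
   case [m = 0] is the simultaneous avoidance event. *)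
have runE m : run X b m = [set w | forall k : int, k <= 0 ->
    tess_boundary (Rs (- m%:Z + k) w) `&` (dilate (a ^ k) W)° = set0].
  apply/seteqP; split=> w /= h.
    apply/int_npos => j; apply/(boundary_avoids_dilate hW hW0 hRs) => //.
    - exact: ak1.
    - by have := h j; rewrite /X /backward_copies PoszD opprD.
  move=> j; have /int_npos/(_ j) := h.
  move/(boundary_avoids_dilate hW hW0 hRs).
  rewrite /X /backward_copies PoszD opprD.
  by apply => //; exact: ak1.
rewrite p0E !powE; split.
- move=> k k0; rewrite powE (copies_avoid_prob hLambda hY hW hW0 hRs)//.
  exact: ak1.
- rewrite -(pr_run mX iX mb prb bq 0) -(prE _ (measurable_run mX mb 0)) runE.
  by congr (P _); apply/seteqP; split=> w /= h k /h; rewrite oppr0 add0r.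
- by rewrite lte_fin expR_gt0.
(* The exceptional set: no run starts at or after some [M]. It is a countable union of null sets,
   and off it runs start at arbitrarily large indices. *)
- exists (\bigcup_M \bigcap_(m in [set m | (M <= m)%N]) ~` run X b m).
  have mN M : measurable (\bigcap_(m in [set m | (M <= m)%N]) ~` run X b m).
    apply: bigcap_measurable; first by exists M => /=.
    by move=> k _; apply: measurableC; exact: measurable_run.
  split.
  + by apply: bigcupT_measurable.
  + apply/(negligibleP P (bigcupT_measurable _ mN)).
    apply: negligible_bigcup => M; apply/negligibleP => //.
    have := prE P (mN M).
    by rewrite (no_run_null mX iX mb prb bq (expR_gt0 _) M).
  + move=> w; apply: contra_notP => nN.
    have io M : exists2 m, (M <= m)%N & run X b m w.
      apply: contrapT => no; apply: nN; exists M => // m Mm rw.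
      by apply: no; exists m.
    (* The lower bound 1 gives [n_i >= 1]. *)
    have [n [n1 nS nrun]] := increasing_choice 1 io.
    exists (fun i => (n i)%:Z); split.
    * by move=> i; rewrite lez_nat.
    * by move=> i; rewrite ltz_nat.
    * by move=> i; have := nrun i; rewrite runE.
Qed.
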